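(* Let $U_\alpha(\mathfrak{g})$ be the quantum (1+1) centrally extended Poincaré algebra with generators $M,P_0,P_1,K$, coproducts $$\begin{aligned} \Delta(M)&=M\otimes1+e^{-\alpha P_1}\otimes M+(e^{-\alpha P_1}-1)\otimes P_0,\quad &\Delta(P_0)&=P_0\otimes1+1\otimes P_0,\\ \Delta(P_1)&=P_1\otimes1+1\otimes P_1,\quad &\Delta(K)&=K\otimes e^{\alpha P_1}+1\otimes K, \end{aligned}$$ and commutation relations $[P_0,P_1]=[M,P_0]=[M,P_1]=0$, $[K,P_0]=\frac{e^{\alpha P_1}-1}{\alpha}$, $[K,P_1]=(M+P_0)e^{\alpha P_1}$, $[K,M]=-\big(\frac{\cosh(\alpha P_1)-1}{\alpha}+\frac{\alpha}{2}(M+P_0)^2e^{\alpha P_1}\big)$. Let its dual quantum Poincaré group have coordinates $\theta,a_0,a_1,\chi$ with $$\begin{aligned} \Delta(\theta)&=\theta\otimes1+1\otimes\theta+(\cosh\chi-1)\otimes a_0+\sinh\chi\otimes a_1,\\ \Delta(a_0)&=a_0\otimes1+\cosh\chi\otimes a_0+\sinh\chi\otimes a_1,\\ \Delta(a_1)&=a_1\otimes1+\cosh\chi\otimes a_1+\sinh\chi\otimes a_0,\quad \Delta(\chi)=\chi\otimes1+1\otimes\chi, \end{aligned}$$ $[a_0,a_1]=\alpha\theta$, $[\theta,a_0]=0$, $[\theta,a_1]=\alpha\theta$, $[\chi,\theta]=[\chi,a_0]=\alpha(\cosh\chi-1)$, $[\chi,a_1]=\alpha\sinh\chi$, and let $T=e^{\theta\otimes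 M}e^{a_0\otimes P_0}e^{a_1\otimes P_1}e^{\chi\otimes K}$ be the universal $T$-matrix. Consider the contraction maps $$\phi_c(M)=c^{-2}M,\quad\phi_c(P_0)=P_0,\quad\phi_c(P_1)=c^{-1}P_1,\quad\phi_c(K)=c^{-1}K,$$ $$\varphi_c(\theta)=c^{2}\theta,\quad\varphi_c(a_0)=a_0,\quad\varphi_c(a_1)=c\,a_1,\quad\varphi_c(\chi)=c\,\chi,$$ with deformation parameter transformation $\alpha'=\phi_c(\alpha)=\varphi_c(\alpha)=\alpha c$. Then, in the limit $c\to+\infty$ and writing $b,a,v$ for the contracted coordinates $a_0,a_1,\chi$: (i) the contracted quantum algebra is the quantum (1+1) centrally extended Galilei algebra with (all other commutators vanishing) $$[P_0,P_1]'=0,\quad[K,M]'=-\frac{\alpha'}{2}M^2e^{\alpha'P_1},\quad[K,P_0]'=\frac{e^{\alpha'P_1}-1}{\alpha'},\quad[K,P_1]'=Me^{\alpha'P_1},$$ $$\Delta'(M)=M\otimes1+e^{-\alpha'P_1}\otimes M,\quad\Delta'(P_0)=P_0\otimes1+1\otimes P_0,\quad\Delta'(P_1)=P_1\otimes1+1\otimes P_1,\quad\Delta'(K)=K\otimes e^{\alpha'P_1}+1\otimes K;$$ (ii) the contracted quantum group is the quantum Galilei group with (all other commutators vanishing) $$[b,a]'=0,\quad[\theta,a]'=\alpha'\theta,\quad[\theta,v]'=-\tfrac12\alpha'v^2,\quad[a,v]'=-\alpha'v,$$ $$\begin{aligned} \Delta'(\theta)&=\theta\otimes1+1\otimes\theta+v\otimes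 a+\tfrac12v^2\otimes b,\quad &\Delta'(b)&=b\otimes1+1\otimes b,\\ \Delta'(a)&=a\otimes1+1\otimes a+v\otimes b,\quad &\Delta'(v)&=v\otimes1+1\otimes v; \end{aligned}$$ (iii) the contracted universal $T$-matrix is the Galilei $T$-matrix $$T'=e^{\theta\otimes M}\,e^{b\otimes P_0}\,e^{a\otimes P_1}\,e^{v\otimes K}.$$
   Context: Everything is formal in the deformation parameter (power series with termwise limits of coefficients). The contraction of the quantum algebra is defined by $$[X,Y]'=\lim_{c\to+\infty}\phi_c^{-1}\big([\phi_c(X),\phi_c(Y)]\big),\qquad\Delta'=\lim_{c\to+\infty}(\phi_c^{-1}\otimes\phi_c^{-1})\circ\Delta\circ\phi_c,$$ where $\phi_c$ is extended multiplicatively and $\phi_c^{-1}$ also replaces the deformation parameter $\alpha$ by $\alpha'/c$ (so $\phi_c^{-1}$ substitutes $M\to c^2M$, $P_0\to P_0$, $P_1\to cP_1$, $K\to cK$, $\alpha\to\alpha'/c$). The contraction of the quantum group is defined by the same formulas with $\varphi_c$ in place of $\phi_c$; $\varphi_c$ is the map dual to $\phi_c$, i.e. it preserves the pairing $\langle\varphi_c(x_i),\phi_c(X^j)\rangle=\delta_i^j$ between coordinates $(\theta,a_0,a_1,\chi)$ and generators $(M,P_0,P_1,K)$. The contraction of the universal $T$-matrix $T=\sum_\mu x_\mu\otimes X^\mu$ (canonical element for dual bases of the quantum group and quantum algebra) is $$T'=\lim_{c\to+\infty}(\varphi_c\otimes\phi_c)T=\lim_{c\to+\infty}\sum_\mu\varphi_c(x_\mu)\otimes\phi_c(X^\mu).$$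 Here $e^{x\otimes X}=\sum_{n\ge0}\frac{1}{n!}x^n\otimes X^n$. *)

(* Defs.v *)
From HB Require Import structures.
From mathcomp Require Import all_boot all_order all_algebra.
From mathcomp Require Import all_classical all_reals.
From mathcomp Require Import topology normedtype.

Set Implicit Arguments.
Unset Strict Implicit.
Unset Printing Implicit Defensive.

Import Order.TTheory GRing.Theory Num.Theory.
Import numFieldNormedType.Exports.

Local Open Scope classical_set_scope.
Local Open Scope ring_scope.

(* The exponents (i, j, k, l) of an ordered monomial X1^i X2^j X3^k X4^l. The
   ordered generators are (M, P0, P1, K) for the quantum algebras and
   (theta, a0, a1, chi), resp. (theta, b, a, v), for the quantum groups; this
   is the ordering used in the T-matrix. *)
Notation mono := (nat * nat * nat * nat)%type.

Definition mono0 : mono := (0, 0, 0, 0)%N.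

(* [x N m] is the coefficient of alpha^N X^m in x, where alpha is the
   deformation parameter; the monomials X^m are indexed by I (I = mono, or
   I = mono * mono for a completed tensor product over R[[alpha]]). *)
Definition series (R : realType) (I : Type) : Type := nat -> I -> R^o.

HB.instance Definition _ (R : realType) (I : Type) :=
  GRing.Lmodule.on (series R I).

Section Series.
Variable R : realType.
Implicit Types I J : choiceType.

Definition monom I (m : I) : series R I :=
  fun N l => ((N == 0%N) && (l == m))%:R.

Definition alpha_mul I (x : series R I) : series R I :=
  fun N m => if N is N'.+1 then x N' m else 0.

(* Division by alpha, for a series with no term of order 0 in alpha. *)
Definition alpha_div I (x : series R I) : series R I := fun N m => x N.+1 m.

(* Formal sum of a family of which only finitely many terms contribute to each
   coefficient. *)
Definition fsum I (z : nat -> series R I) : series R I :=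
  fun N m => \sum_(n \in [set: nat]) z n N m.

Definition tens I J (x : series R I) (y : series R J) : series R (I * J)%type :=
  fun N p => \sum_(i < N.+1) x i p.1 * y (N - i)%N p.2.

(* Structure constants of a product: [g m n N l] is the coefficient of
   alpha^N X^l in X^m X^n. *)
Definition structc (I : Type) : Type := I -> I -> nat -> I -> R.

(* The R[[alpha]]-bilinear product with structure constants g. The sum over
   pairs of monomials has finite support in all uses, thanks to [alg_finite]
   and [grp_finite] below. *)
Definition mul I (g : structc I) (x y : series R I) : series R I :=
  fun N l => \sum_(i < N.+1) \sum_(j < (N - i).+1)
    \sum_(p \in [set: I * I]) x i p.1 * y j p.2 * g p.1 p.2 (N - i - j)%N l.

Definition comm I (g : structc I) (x y : series R I) : series R I :=
  mul g x y - mul g y x.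

(* Structure constants of (x (x) y)(x' (x) y') = x x' (x) y y'. *)
Definition tens_structc I J (g : structc I) (h : structc J) :
    structc (I * J)%type :=
  fun p q N l => \sum_(i < N.+1)
    g p.1 q.1 i l.1 * h p.2 q.2 (N - i)%N l.2.

Definition pow (g : structc mono) (x : series R mono) (n : nat) :
    series R mono :=
  iter n (mul g x) (monom mono0).

Definition fexp (g : structc mono) (x : series R mono) : series R mono :=
  fsum (fun n => (n`!%:R)^-1 *: pow g x n).

Definition fcosh (g : structc mono) (x : series R mono) : series R mono :=
  2^-1 *: (fexp g x + fexp g (- x)).

Definition fsinh (g : structc mono) (x : series R mono) : series R mono :=
  2^-1 *: (fexp g x - fexp g (- x)).

(* e^{x (x) X} *)
Definition tens_exp (g h : structc mono) (x X : series R mono) :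
    series R (mono * mono)%type :=
  fsum (fun n => (n`!%:R)^-1 *: tens (pow g x n) (pow h X n)).

Definition X1 : series R mono := monom (1, 0, 0, 0)%N.
Definition X2 : series R mono := monom (0, 1, 0, 0)%N.
Definition X3 : series R mono := monom (0, 0, 1, 0)%N.
Definition X4 : series R mono := monom (0, 0, 0, 1)%N.

(* Product and coproduct on ordered monomials: [copc m N (k, l)] is the
   coefficient of alpha^N X^k (x) X^l in the coproduct of X^m. *)
Record hopf_data := HopfData {
  prodc : structc mono;
  copc : mono -> nat -> mono * mono -> R }.

Implicit Types Q U G : hopf_data.

(* The R[[alpha]]-linear extension of the coproduct. *)
Definition cop Q (x : series R mono) : series R (mono * mono)%type :=
  fun N p => \sum_(i < N.+1) \sum_(m \in [set: mono])
    x i m * copc Q m (N - i)%N p.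

(* A bialgebra over R[[alpha]] with the ordered monomials in X1, X2, X3, X4 as
   topological basis, and with counit vanishing on the generators (so that the
   counit of x is its coefficient at the empty monomial). By linearity and
   continuity the axioms need only be required on basis elements. *)
Record bialgebra Q : Prop := {
  bialg_mul1l : forall m, mul (prodc Q) (monom mono0) (monom m) = monom m;
  bialg_mul1r : forall m, mul (prodc Q) (monom m) (monom mono0) = monom m;
  bialg_mulA : forall k l m,
    mul (prodc Q) (monom k) (mul (prodc Q) (monom l) (monom m)) =
    mul (prodc Q) (mul (prodc Q) (monom k) (monom l)) (monom m);
  bialg_ordered : forall i j k l : nat,
    mul (prodc Q) (mul (prodc Q) (mul (prodc Q)
      (pow (prodc Q) X1 i) (pow (prodc Q) X2 j)) (pow (prodc Q) X3 k))
      (pow (prodc Q) X4 l) = monom (i, j, k, l);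
  bialg_cop1 : cop Q (monom mono0) = monom (mono0, mono0);
  bialg_copM : forall l m,
    cop Q (mul (prodc Q) (monom l) (monom m)) =
    mul (tens_structc (prodc Q) (prodc Q)) (cop Q (monom l)) (cop Q (monom m));
  bialg_coassoc : forall m N (k l r : mono),
    \sum_(i < N.+1) \sum_(s \in [set: mono])
      copc Q m i (s, r) * copc Q s (N - i)%N (k, l) =
    \sum_(i < N.+1) \sum_(s \in [set: mono])
      copc Q m i (k, s) * copc Q s (N - i)%N (l, r);
  bialg_counitl : forall m N l, copc Q m N (mono0, l) = monom m N l;
  bialg_counitr : forall m N l, copc Q m N (l, mono0) = monom m N l }.

(* A quantum algebra consists of power series in alpha with coefficients
   polynomial in the generators. *)
Definition poly_series (x : series R mono) : Prop :=
  forall N, finite_set [set m | x N m != 0].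

Definition alg_finite Q : Prop :=
  (forall m n, poly_series (prodc Q m n)) /\
  (forall m N, finite_set [set p | copc Q m N p != 0]).

Definition quantum_algebra Q : Prop := alg_finite Q /\ bialgebra Q.

(* A quantum group consists of arbitrary formal power series in alpha and the
   coordinates (as needed for cosh chi); the product and the coproduct are
   continuous for termwise convergence. *)
Definition grp_finite Q : Prop :=
  (forall N l, finite_set [set p : mono * mono | prodc Q p.1 p.2 N l != 0]) /\
  (forall N p, finite_set [set m | copc Q m N p != 0]).

Definition quantum_group Q : Prop := grp_finite Q /\ bialgebra Q.

Definition poincare_algebra U : Prop :=
  let g := prodc U in
  let M := X1 in let P0 := X2 in let P1 := X3 in let K := X4 in
  let one := monom mono0 in
  let E := fexp g (alpha_mul P1) in
  let E' := fexp g (- alpha_mul P1) in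
  [/\ cop U M = tens M one + tens E' M + tens (E' - one) P0,
      cop U P0 = tens P0 one + tens one P0,
      cop U P1 = tens P1 one + tens one P1 &
      cop U K = tens K E + tens one K] /\
  [/\ comm g P0 P1 = 0, comm g M P0 = 0 & comm g M P1 = 0] /\
  [/\ comm g K P0 = alpha_div (E - one),
      comm g K P1 = mul g (M + P0) E &
      comm g K M = - (alpha_div (fcosh g (alpha_mul P1) - one)
        + 2^-1 *: alpha_mul (mul g (pow g (M + P0) 2) E))].

Definition galilei_algebra U : Prop :=
  let g := prodc U in
  let M := X1 in let P0 := X2 in let P1 := X3 in let K := X4 in
  let one := monom mono0 in
  let E := fexp g (alpha_mul P1) in
  let E' := fexp g (- alpha_mul P1) in
  [/\ cop U M = tens M one + tens E' M,
      cop U P0 = tens P0 one + tens one P0,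
      cop U P1 = tens P1 one + tens one P1 &
      cop U K = tens K E + tens one K] /\
  [/\ comm g P0 P1 = 0, comm g M P0 = 0 & comm g M P1 = 0] /\
  [/\ comm g K P0 = alpha_div (E - one),
      comm g K P1 = mul g M E &
      comm g K M = - (2^-1 *: alpha_mul (mul g (pow g M 2) E))].

Definition poincare_group G : Prop :=
  let g := prodc G in
  let theta := X1 in let a0 := X2 in let a1 := X3 in let chi := X4 in
  let one := monom mono0 in
  let ch := fcosh g chi in
  let sh := fsinh g chi in
  [/\ cop G theta = tens theta one + tens one theta
        + tens (ch - one) a0 + tens sh a1,
      cop G a0 = tens a0 one + tens ch a0 + tens sh a1,
      cop G a1 = tens a1 one + tens ch a1 + tens sh a0 &
      cop G chi = tens chi one + tens one chi] /\
  [/\ comm g a0 a1 = alpha_mul theta,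
      comm g theta a0 = 0 &
      comm g theta a1 = alpha_mul theta] /\
  [/\ comm g chi theta = alpha_mul (ch - one),
      comm g chi a0 = alpha_mul (ch - one) &
      comm g chi a1 = alpha_mul sh].

Definition galilei_group G : Prop :=
  let g := prodc G in
  let theta := X1 in let b := X2 in let a := X3 in let v := X4 in
  let one := monom mono0 in
  [/\ cop G theta = tens theta one + tens one theta
        + tens v a + 2^-1 *: tens (pow g v 2) b,
      cop G b = tens b one + tens one b,
      cop G a = tens a one + tens one a + tens v b &
      cop G v = tens v one + tens one v] /\
  [/\ comm g b a = 0, comm g theta b = 0 & comm g b v = 0] /\
  [/\ comm g theta a = alpha_mul theta,
      comm g theta v = - (2^-1 *: alpha_mul (pow g v 2)) &
      comm g a v = - alpha_mul v].

Definition mono_fact (m : mono) : R :=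
  (m.1.1.1`! * m.1.1.2`! * m.1.2`! * m.2`!)%:R.

(* The R[[alpha]]-bilinear pairing (with values in R[[alpha]]) for which
   <X^l, X^m> = m! if l = m and 0 otherwise. *)
Definition pairing I (w : I -> R) (x y : series R I) : nat -> R :=
  fun N => \sum_(i < N.+1) \sum_(m \in [set: I]) w m * x i m * y (N - i)%N m.

Definition pair1 : series R mono -> series R mono -> nat -> R :=
  pairing mono_fact.

Definition pair2 :
    series R (mono * mono)%type -> series R (mono * mono)%type -> nat -> R :=
  pairing (fun p : mono * mono => mono_fact p.1 * mono_fact p.2).

(* Under this pairing the product of G is dual to the coproduct of U and
   conversely, i.e. the theta^i a0^j a1^k chi^l / (i! j! k! l!) and the
   M^i P0^j P1^k K^l are dual bases. *)
Definition dual_pair G U : Prop :=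
  (forall l m n : mono,
    pair1 (mul (prodc G) (monom l) (monom m)) (monom n) =
    pair2 (tens (monom l) (monom m)) (cop U (monom n))) /\
  (forall l m n : mono,
    pair1 (monom n) (mul (prodc U) (monom l) (monom m)) =
    pair2 (cop G (monom n)) (tens (monom l) (monom m))).

Definition T_matrix G U : series R (mono * mono)%type :=
  let t := tens_structc (prodc G) (prodc U) in
  mul t (mul t (mul t
    (tens_exp (prodc G) (prodc U) X1 X1)
    (tens_exp (prodc G) (prodc U) X2 X2))
    (tens_exp (prodc G) (prodc U) X3 X3))
    (tens_exp (prodc G) (prodc U) X4 X4).

Definition mono_eval (s : R * R * R * R) (m : mono) : R :=
  s.1.1.1 ^+ m.1.1.1 * s.1.1.2 ^+ m.1.1.2 * s.1.2 ^+ m.1.2 * s.2 ^+ m.2.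

(* The substitution X_i -> s_i X_i, alpha -> t alpha, extended
   multiplicatively to the ordered monomials and to series. *)
Definition rescale (t : R) (s : R * R * R * R) (x : series R mono) :
    series R mono :=
  fun N m => t ^+ N * mono_eval s m * x N m.

Definition rescale2 (t : R) (s s' : R * R * R * R)
    (x : series R (mono * mono)%type) : series R (mono * mono)%type :=
  fun N p => t ^+ N * mono_eval s p.1 * mono_eval s' p.2 * x N p.

(* Factors of (M, P0, P1, K) under phi_c, which are also those of
   (theta, a0, a1, chi) under the inverse of varphi_c. *)
Definition scale_down (c : R) : R * R * R * R := (c ^- 2, 1, c^-1, c^-1).

(* Factors of (theta, a0, a1, chi) under varphi_c, which are also those of
   (M, P0, P1, K) under the inverse of phi_c. *)
Definition scale_up (c : R) : R * R * R * R := (c ^+ 2, 1, c, c).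

(* The source of phi_c and varphi_c has deformation parameter
   alpha' = c alpha, the target alpha. *)
Definition phi (c : R) := rescale c (scale_down c).
Definition phi_inv (c : R) := rescale c^-1 (scale_up c).
Definition phi_inv2 (c : R) := rescale2 c^-1 (scale_up c) (scale_up c).
Definition varphi (c : R) := rescale c (scale_up c).
Definition varphi_inv (c : R) := rescale c^-1 (scale_down c).
Definition varphi_inv2 (c : R) := rescale2 c^-1 (scale_down c) (scale_down c).
Definition varphi_phi (c : R) := rescale2 c (scale_up c) (scale_down c).

Definition termwise_lim I (f : R -> series R I) (l : series R I) : Prop :=
  forall N m, (f c N m : R) @[c --> +oo] --> (l N m : R).

(* The bracket and the coproduct of U' are the contractions of those of U, on
   all elements of the algebra. *)
Definition algebra_contraction U U' : Prop :=
  (forall X Y, poly_series X -> poly_series Y ->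
    termwise_lim
      (fun c => phi_inv c (comm (prodc U) (phi c X) (phi c Y)))
      (comm (prodc U') X Y)) /\
  (forall X, poly_series X ->
    termwise_lim (fun c => phi_inv2 c (cop U (phi c X))) (cop U' X)).

Definition group_contraction G G' : Prop :=
  (forall x y,
    termwise_lim
      (fun c => varphi_inv c (comm (prodc G) (varphi c x) (varphi c y)))
      (comm (prodc G') x y)) /\
  (forall x,
    termwise_lim (fun c => varphi_inv2 c (cop G (varphi c x))) (cop G' x)).

End Series.

(* Main.v *)
(** Give alpha the weight -1 and the ordered generators the weights 2, 0, 1, 1
    for the quantum algebra, and the opposite weights for the quantum group.
    Conjugation by phi_c, resp. varphi_c, multiplies each structure constant by
    c^e, where e is the weight of the output minus the weight of the inputs.
    Hence the contraction exists when the structure constants with e > 0 vanish,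
    and then it is the associated graded bialgebra, all of whose axioms and
    relations are homogeneous parts of those of the original one.

    The vanishing is proved for the quantum group, which is commutative modulo
    alpha: reordering a product of generators only creates terms with a
    commutator, hence with a factor alpha, so that an induction on the order in
    alpha applies. The coproduct of the group is filtered because it is so on
    generators, and duality transfers the filtration to the quantum algebra.

    Since ordered products of generators are the basis monomials, the T-matrix of
    any two such bialgebras is the sum of the x^m (x) X^m / m!, which the
    rescalings leave invariant. *)

Require Import Defs.
From mathcomp Require Import all_boot all_order all_algebra.
From mathcomp Require Import all_classical all_reals.
From mathcomp Require Import topology normedtype.
From mathcomp Require Import finmap zify ring.

Set Implicit Arguments.
Unset Strict Implicit.
Unset Printing Implicit Defensive.

Import Order.TTheory GRing.Theory Num.Theory.
Import numFieldNormedType.Exports.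
Import Defs.

Local Open Scope classical_set_scope.
Local Open Scope ring_scope.

(** * Formal series *)

Section Fsbig.
Variables (R : realType) (I : choiceType).
Implicit Types F H : I -> R.

Lemma fsbig_single F i0 : (forall i, i != i0 -> F i = 0) ->
  \sum_(i \in [set: I]) F i = F i0.
Proof.
move=> F0; rewrite (fsbigTE [fset i0]%fset); first by rewrite big_seq_fset1.
by move=> i; rewrite in_fset1 => /F0.
Qed.

(** A sum with infinite support is 0 by convention, so additivity is only available for finite
    supports; both sums are then taken over the union of the supports. *)
Lemma fsbigTB F H : finite_set [set i | F i != 0] ->
  finite_set [set i | H i != 0] ->
  \sum_(i \in [set: I]) (F i - H i) =
  \sum_(i \in [set: I]) F i - \sum_(i \in [set: I]) H i.
Proof.
move=> finF finH.
have suppP (E : I -> R) (finE : finite_set [set i | E i != 0]) i :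
    i \notin fset_set [set i | E i != 0] -> E i = 0.
  by apply: contraNeq => ?; rewrite in_fset_set// mem_set.
pose A := (fset_set [set i | F i != 0] `|` fset_set [set i | H i != 0])%fset.
have AF i : i \notin A -> F i = 0.
  by rewrite in_fsetU negb_or => /andP[/(suppP _ finF)].
have AH i : i \notin A -> H i = 0.
  by rewrite in_fsetU negb_or => /andP[_ /(suppP _ finH)].
rewrite !(fsbigTE A)// ?sumrB// => i iA.
by rewrite AF ?AH ?subrr.
Qed.

(** [H] bounds the support of [f c] by a finite set independent of [c], which permits the exchange
    of limit and sum. *)
Lemma cvg_fsbig (f : R -> I -> R) H : finite_set [set i | H i != 0] ->
  (forall c i, H i = 0 -> f c i = 0) ->
  forall h : I -> R, (forall i, f c i @[c --> +oo] --> h i) ->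
  \sum_(i \in [set: I]) f c i @[c --> +oo] --> \sum_(i \in [set: I]) h i.
Proof.
move=> finH fH h fh.
have H0 i : i \notin fset_set [set i | H i != 0] -> H i = 0.
  by apply: contraNeq => ?; rewrite in_fset_set// mem_set.
(* The limit inherits the support bound: where [H] vanishes it is the limit of the constant 0. *)
have hH i : H i = 0 -> h i = 0.
  move=> Hi; rewrite -(cvg_lim (@Rhausdorff R) (fh i)).
  apply: (cvg_lim (@Rhausdorff R)).
  by under eq_cvg do rewrite (fH _ _ Hi); exact: cvg_cst.
rewrite (fsbigTE (fset_set [set i | H i != 0]))//; last by move=> i /H0/hH.
under eq_cvg do rewrite (fsbigTE (fset_set [set i | H i != 0])) => [|i /H0/fH//].
by apply: cvg_big => [|i _]; [exact: add_continuous|exact: fh].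
Qed.

End Fsbig.

Lemma sum_ord_single (V : nmodType) n (F : 'I_n -> V) i0 :
  (forall i, i != i0 -> F i = 0) -> \sum_(i < n) F i = F i0.
Proof. by move=> F0; rewrite (bigD1 i0)//= big1 ?addr0. Qed.

Section SeriesBasics.
Variables (R : realType) (I : choiceType).
Implicit Types (x y : series R I) (g : structc R I).

Lemma seriesP x y : (forall N m, x N m = y N m) -> x = y.
Proof. by move=> xy; apply/funext => N; apply/funext => m. Qed.

Lemma seriesD x y N m : (x + y) N m = x N m + y N m. Proof. by []. Qed.
Lemma seriesN x N m : (- x) N m = - x N m. Proof. by []. Qed.
Lemma seriesB x y N m : (x - y) N m = x N m - y N m. Proof. by []. Qed.
Lemma seriesZ a x N m : (a *: x) N m = a * x N m. Proof. by []. Qed.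
Lemma series0 N m : (0 : series R I) N m = 0. Proof. by []. Qed.

Lemma mul_eq0 g x y N l :
  (forall i j p, (i + j <= N)%N ->
    x i p.1 * y j p.2 * g p.1 p.2 (N - i - j)%N l = 0) ->
  mul g x y N l = 0.
Proof.
move=> xy0; rewrite /mul; apply: big1 => i _; apply: big1 => j _.
by apply: fsbig1 => p _; apply: xy0; have := ltn_ord i; have := ltn_ord j; lia.
Qed.

Lemma mul_single i0 j0 p0 g x y N l : (i0 + j0 <= N)%N ->
  (forall i j p, (i + j <= N)%N -> ~~ [&& i == i0, j == j0 & p == p0] ->
    x i p.1 * y j p.2 * g p.1 p.2 (N - i - j)%N l = 0) ->
  mul g x y N l = x i0 p0.1 * y j0 p0.2 * g p0.1 p0.2 (N - i0 - j0)%N l.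
Proof.
move=> ijN xy0; have iN : (i0 < N.+1)%N by lia.
have jN : (j0 < (N - i0).+1)%N by lia.
rewrite /mul (sum_ord_single (i0 := Ordinal iN)) => [|i ii0]; last first.
  apply: big1 => j _; apply: fsbig1 => p _; apply: xy0.
    by have := ltn_ord i; have := ltn_ord j; lia.
  by apply: contra ii0 => /and3P[/eqP ii0 _ _]; apply/eqP/val_inj.
rewrite (sum_ord_single (i0 := Ordinal jN)) => [|j jj0]; last first.
  apply: fsbig1 => p _; apply: xy0; first by have := ltn_ord j; move=> /=; lia.
  by apply: contra jj0 => /and3P[_ /eqP jj0 _]; apply/eqP/val_inj.
rewrite (fsbig_single (i0 := p0)) => [//|p pp0]; apply: xy0 => //=.
by rewrite !eqxx.
Qed.

(** The partial application [g m n] is itself a series, so structure constants and products of basis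
    elements can be interchanged freely. *)
Lemma mul_monomE g m n : mul g (monom R m) (monom R n) = g m n.
Proof.
apply: seriesP => N l; rewrite (@mul_single 0%N 0%N (m, n))//.
  by rewrite /monom/= !eqxx !mul1r !subn0.
move=> i j [p q] _; rewrite /monom /= xpair_eqE.
case: (i == 0%N); rewrite /= ?mul0r//.
case: (j == 0%N); rewrite /= ?(mulr0, mul0r)//.
by rewrite negb_and => /orP[] /negPf->; rewrite ?(mulr0, mul0r).
Qed.

Lemma mul_alphal g x y : mul g (alpha_mul x) y = alpha_mul (mul g x y).
Proof.
apply: seriesP => N l; rewrite /mul big_ord_recl /= [X in X + _]big1 ?add0r.
  by case: N => [|N]; rewrite ?big_ord0.
by move=> j _; apply: fsbig1 => p _; rewrite /= !mul0r.
Qed.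

(** Only the orders 0 and N with the pair [(o, l)] contribute to the coefficient of order N at [l],
    so the unit law passes from the basis to infinite series. *)
Lemma monom1l g o : (forall m, mul g (monom R o) (monom R m) = monom R m) ->
  forall x, mul g (monom R o) x = x.
Proof.
move=> g1 x; apply: seriesP => N l.
have g1E m K k : g o m K k = monom R m K k by rewrite -mul_monomE g1.
rewrite (@mul_single 0%N N (o, l)) ?add0n//=.
  by rewrite g1E /monom subn0 subnn !eqxx mul1r mulr1.
move=> i j [p q] /= ijN; rewrite xpair_eqE /monom.
case: (eqVneq i 0%N) => [i0|]; rewrite /= ?mul0r//.
case: (eqVneq p o) => [->|]; rewrite /= ?mul0r// g1E /monom mul1r.
rewrite negb_and eq_sym => /orP[jN|/negPf]; last first.
  by rewrite eq_sym => ->; rewrite andbF mulr0.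
by rewrite (_ : (_ == 0)%N = false) ?mulr0//; move: jN; lia.
Qed.

Lemma monom1r g o : (forall m, mul g (monom R m) (monom R o) = monom R m) ->
  forall x, mul g x (monom R o) = x.
Proof.
move=> g1 x; apply: seriesP => N l.
have g1E m K k : g m o K k = monom R m K k by rewrite -mul_monomE g1.
rewrite (@mul_single N 0%N (l, o)) ?addn0//=.
  by rewrite g1E /monom subnn !eqxx !mulr1.
move=> i j [p q] /= ijN; rewrite xpair_eqE /monom.
case: (eqVneq j 0%N) => [j0|]; rewrite /= ?(mulr0, mul0r)//.
case: (eqVneq q o) => [->|]; rewrite /= ?(mulr0, mul0r)// g1E /monom andbT mulr1.
rewrite negb_and => /orP[iN|/negPf]; last by rewrite eq_sym => ->; rewrite andbF mulr0.
by rewrite (_ : (_ == 0)%N = false) ?mulr0//; move: iN; lia.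
Qed.

(** For a fixed output coefficient only finitely many pairs of inputs matter, so the sums can be
    split whatever the series; this is the finiteness condition of quantum groups. *)
Lemma mulBl g :
  (forall N l, finite_set [set p : I * I | g p.1 p.2 N l != 0]) ->
  forall x y z, mul g (x - y) z = mul g x z - mul g y z.
Proof.
move=> gfin x y z; apply: seriesP => N l; rewrite seriesB /mul -sumrB.
apply: eq_bigr => i _; rewrite -sumrB; apply: eq_bigr => j _.
rewrite -fsbigTB; first by apply: eq_fsbigr => p _; rewrite seriesB !mulrBl.
- apply: sub_finite_set (gfin (N - i - j)%N l) => p /=.
  by rewrite mulf_eq0 negb_or => /andP[].
- apply: sub_finite_set (gfin (N - i - j)%N l) => p /=.
  by rewrite mulf_eq0 negb_or => /andP[].
Qed.

End SeriesBasics.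

(** * Weight filtration and associated graded bialgebra *)

Section Grading.
Variables (R : realType) (I : choiceType) (w : I -> int).
Implicit Types (x y : series R I) (g : structc R I) (d e : int).

(* [filt d x] says that all terms of x have weight at most d, and [gr d x] is
   the part of x of weight d, where alpha has weight -1. *)
Definition filt d x := forall N m, x N m != 0 -> w m <= N%:Z + d.

(** The filtration condition modulo alpha^K, the form in which it is proved by induction on the
    order in alpha. *)
Definition filt_mod K d x :=
  forall N m, (N < K)%N -> x N m != 0 -> w m <= N%:Z + d.

Definition gr d x : series R I :=
  fun N m => if w m == N%:Z + d then x N m else 0.

Definition sfilt g := forall m n, filt (w m + w n) (g m n).

Definition sgr g : structc R I := fun m n => gr (w m + w n) (g m n).

Lemma filtW d x : (forall K, filt_mod K d x) -> filt d x.
Proof. by move=> h N m; apply: (h N.+1). Qed.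

Lemma filt_filt_mod d x K : filt d x -> filt_mod K d x.
Proof. by move=> h N m _; exact: h. Qed.

Lemma filt_modB K d x y : filt_mod K d x -> filt_mod K d y ->
  filt_mod K d (x - y).
Proof.
move=> hx hy N m NK; rewrite seriesB; have [x0|/(hx _ _ NK)//] := eqVneq (x N m) 0.
have [y0|/(hy _ _ NK)//] := eqVneq (y N m) 0.
by rewrite x0 y0 subrr eqxx.
Qed.

Lemma filt_modN K d x : filt_mod K d x -> filt_mod K d (- x).
Proof. by move=> hx N m NK; rewrite seriesN oppr_eq0; exact: hx. Qed.

(** A factor alpha lowers the weight by 1 and gains one order of precision; this gain drives the
    induction on K. *)
Lemma filt_mod_alpha_mul K d x :
  filt_mod K (d + 1) x -> filt_mod K.+1 d (alpha_mul x).
Proof. by move=> hx [|N] m NK /=; [rewrite eqxx|move/(hx N m NK); lia]. Qed.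

(** Orders in alpha add up in a product, so its coefficients of order below K involve only such
    coefficients of the factors and of [g]. *)
Lemma filt_mod_mul K g d e x y :
  (forall m n, filt_mod K (w m + w n) (g m n)) ->
  filt_mod K d x -> filt_mod K e y -> filt_mod K (d + e) (mul g x y).
Proof.
move=> hg hx hy N l NK; apply: contraNT; rewrite -ltNge => lt_l.
apply/eqP/mul_eq0 => i j p ijN; apply/eqP; apply: contraTT lt_l.
rewrite !mulf_eq0 !negb_or => /andP[/andP[xn yn] gn]; rewrite -leNgt.
have := hx _ _ _ xn; have := hy _ _ _ yn; have := hg _ _ _ _ _ gn.
by lia.
Qed.

Lemma filt_mul g d e x y : sfilt g ->
  filt d x -> filt e y -> filt (d + e) (mul g x y).
Proof.
move=> hg hx hy; apply: filtW => K.
by apply: filt_mod_mul => *; exact: filt_filt_mod.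
Qed.

Lemma filt_le d e x : d <= e -> filt d x -> filt e x.
Proof. by move=> de hx N m /hx; lia. Qed.

Lemma filt_monom m : filt (w m) (monom R m).
Proof.
move=> N l; rewrite /monom; have [->|_] := eqVneq N 0%N; last by rewrite eqxx.
by have [->|_] := eqVneq l m; [rewrite add0r|rewrite eqxx].
Qed.

Lemma filtD d x y : filt d x -> filt d y -> filt d (x + y).
Proof.
move=> hx hy N m; rewrite seriesD; have [x0|/hx//] := eqVneq (x N m) 0.
by have [y0|/hy//] := eqVneq (y N m) 0; rewrite x0 y0 addr0 eqxx.
Qed.

Lemma filtN d x : filt d x -> filt d (- x).
Proof. by move=> hx N m; rewrite seriesN oppr_eq0; exact: hx. Qed.

Lemma filtB d x y : filt d x -> filt d y -> filt d (x - y).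
Proof. by move=> hx hy; apply: filtD => //; exact: filtN. Qed.

Lemma filtZ d a x : filt d x -> filt d (a *: x).
Proof. by move=> hx N m; rewrite seriesZ mulf_eq0 negb_or => /andP[_ /hx]. Qed.

Lemma filt0 d : filt d 0.
Proof. by move=> N m; rewrite series0 eqxx. Qed.

Lemma filt_alpha_mul d x : filt (d + 1) x -> filt d (alpha_mul x).
Proof. by move=> hx [|N] m /=; [rewrite eqxx|move/hx; lia]. Qed.

Lemma filt_fsum d (z : nat -> series R I) :
  (forall n, filt d (z n)) -> filt d (fsum z).
Proof.
move=> hz N m; apply: contraNT; rewrite -ltNge => lt_m; apply/eqP/fsbig1 => n _.
by apply/eqP; apply: contraTT lt_m => /hz; rewrite -leNgt.
Qed.

Lemma grD d x y : gr d (x + y) = gr d x + gr d y.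
Proof. by apply: seriesP => N m; rewrite seriesD /gr; case: eqP; rewrite ?addr0. Qed.

Lemma grN d x : gr d (- x) = - gr d x.
Proof. by apply: seriesP => N m; rewrite seriesN /gr; case: eqP; rewrite ?oppr0. Qed.

Lemma grB d x y : gr d (x - y) = gr d x - gr d y.
Proof. by rewrite grD grN. Qed.

Lemma grZ d a x : gr d (a *: x) = a *: gr d x.
Proof. by apply: seriesP => N m; rewrite seriesZ /gr; case: eqP; rewrite ?mulr0. Qed.

Lemma gr0 d : gr d 0 = 0.
Proof. by apply: seriesP => N m; rewrite /gr; case: eqP. Qed.

Lemma gr_monom m : gr (w m) (monom R m) = monom R m.
Proof.
apply: seriesP => N l; rewrite /gr /monom; case: eqP => //.
by have [->|//] := eqVneq N 0%N; have [->|//] := eqVneq l m; rewrite add0r.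
Qed.

(** This discards the terms of a Poincaré relation that disappear in the contraction. *)
Lemma gr_filt_lt d e x : filt d x -> d < e -> gr e x = 0.
Proof.
move=> hx de; apply: seriesP => N m; rewrite /gr; case: eqP => // wm.
by apply/eqP; apply: contraTT de => /hx; lia.
Qed.

Lemma gr_alpha_mul d x : gr d (alpha_mul x) = alpha_mul (gr (d + 1) x).
Proof.
apply: seriesP => -[|N] m; rewrite /gr /=; first by case: eqP.
by rewrite (_ : N.+1%:Z + d = N%:Z + (d + 1)); last lia.
Qed.

Lemma gr_alpha_div d x : gr d (alpha_div x) = alpha_div (gr (d - 1) x).
Proof.
apply: seriesP => N m; rewrite /gr /alpha_div.
by rewrite (_ : N.+1%:Z + (d - 1) = N%:Z + d); last lia.
Qed.

Lemma gr_fsum d (z : nat -> series R I) :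
  gr d (fsum z) = fsum (fun n => gr d (z n)).
Proof.
apply: seriesP => N m; rewrite /gr /fsum; case: eqP => // _.
by rewrite fsbig1.
Qed.

(** Each contribution to the product has weight at most d + e, with equality only if the bounds on
    [x], [y] and [g] are all attained. Hence the part of weight d + e involves top parts only. *)
Lemma mul_gr g d e x y : sfilt g -> filt d x -> filt e y ->
  mul (sgr g) (gr d x) (gr e y) = gr (d + e) (mul g x y).
Proof.
move=> hg hx hy; apply: seriesP => N l; rewrite {3}/gr; case: eqP => wl.
  rewrite /mul; apply: eq_bigr => i _; apply: eq_bigr => j _.
  apply: eq_fsbigr => p _; rewrite /sgr /gr.
  have [x0|/hx xn] := eqVneq (x i p.1) 0; first by rewrite x0 if_same !mul0r.
  have [y0|/hy yn] := eqVneq (y j p.2) 0; first by rewrite y0 if_same !(mul0r, mulr0).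
  have [g0|/hg gn] := eqVneq (g p.1 p.2 (N - i - j)%N l) 0.
    by rewrite g0 if_same !mulr0.
  by rewrite !ifT//; apply/eqP; have := ltn_ord i; have := ltn_ord j; lia.
apply: mul_eq0 => i j p ijN; rewrite /sgr /gr.
case: eqP => xi; rewrite ?mul0r//; case: eqP => yj; rewrite ?(mul0r, mulr0)//.
by case: eqP => gl; rewrite ?mulr0//; exfalso; apply: wl; lia.
Qed.

End Grading.

Section Graded_pow.
Variables (R : realType) (w : mono -> int).
Hypothesis w0 : w mono0 = 0.
Variable g : structc R mono.
Hypothesis hg : sfilt w g.
Implicit Types x y : series R mono.

Lemma filt_one : filt w 0 (monom R mono0).
Proof. by rewrite -w0; exact: filt_monom. Qed.

Lemma gr_one : gr w 0 (monom R mono0) = monom R mono0.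
Proof. by rewrite -{1}w0 gr_monom. Qed.

Lemma filt_pow d x n : filt w d x -> filt w (d *+ n) (pow g x n).
Proof.
move=> hx; elim: n => [|n IHn]; first exact: filt_one.
by rewrite mulrS; apply: filt_mul.
Qed.

Lemma pow_gr d x n : filt w d x ->
  pow (sgr w g) (gr w d x) n = gr w (d *+ n) (pow g x n).
Proof.
move=> hx; elim: n => [|n IHn]; first by rewrite /= gr_one.
by rewrite mulrS /= IHn mul_gr//; exact: filt_pow.
Qed.

(** Weight 0 is the case in which all powers of the exponent obey the same bound. *)
Lemma filt_fexp x : filt w 0 x -> filt w 0 (fexp g x).
Proof.
move=> hx; apply: filt_fsum => n; apply: filtZ.
by rewrite -(mul0rn _ n); exact: filt_pow.
Qed.

Lemma fexp_gr x : filt w 0 x -> fexp (sgr w g) (gr w 0 x) = gr w 0 (fexp g x).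
Proof.
move=> hx; rewrite /fexp gr_fsum; congr fsum; apply/funext => n.
by rewrite grZ pow_gr// mul0rn.
Qed.

Lemma comm_gr d e x y : filt w d x -> filt w e y ->
  comm (sgr w g) (gr w d x) (gr w e y) = gr w (d + e) (comm g x y).
Proof. by move=> hx hy; rewrite /comm grB !mul_gr// (addrC e). Qed.

End Graded_pow.

Definition wprod (I J : Type) (w : I -> int) (v : J -> int) (p : I * J) : int :=
  w p.1 + v p.2.

(** * Gradings on tensor products *)

Section Graded_tensor.
Variables (R : realType) (I J : choiceType) (w : I -> int) (v : J -> int).

Lemma filt_tens d e (x : series R I) (y : series R J) :
  filt w d x -> filt v e y -> filt (wprod w v) (d + e) (tens x y).
Proof.
move=> hx hy N p; apply: contraNT; rewrite -ltNge => lt_p.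
apply/eqP/big1 => i _; apply/eqP; apply: contraTT lt_p.
rewrite mulf_eq0 negb_or => /andP[/hx xn /hy yn]; rewrite -leNgt /wprod.
by have := ltn_ord i; lia.
Qed.

Lemma tens_gr d e (x : series R I) (y : series R J) :
  filt w d x -> filt v e y ->
  tens (gr w d x) (gr v e y) = gr (wprod w v) (d + e) (tens x y).
Proof.
move=> hx hy; apply: seriesP => N p; rewrite {3}/gr /wprod; case: eqP => wp.
  apply: eq_bigr => i _; rewrite /gr.
  have [x0|/hx xn] := eqVneq (x i p.1) 0; first by rewrite x0 if_same !mul0r.
  have [y0|/hy yn] := eqVneq (y (N - i)%N p.2) 0; first by rewrite y0 if_same !mulr0.
  by rewrite !ifT//; apply/eqP; have := ltn_ord i; lia.
apply: big1 => i _; rewrite /gr; have := ltn_ord i.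
case: eqP => xi; rewrite ?mul0r//; case: eqP => yj; rewrite ?mulr0//.
by move=> iN; exfalso; apply: wp; lia.
Qed.

Lemma tens_structcE (g : structc R I) (h : structc R J) p q :
  tens_structc g h p q = tens (g p.1 q.1) (h p.2 q.2).
Proof. by []. Qed.

Lemma sfilt_tens_structc (g : structc R I) (h : structc R J) :
  sfilt w g -> sfilt v h -> sfilt (wprod w v) (tens_structc g h).
Proof. by move=> hg hh p q; rewrite tens_structcE /wprod addrACA; apply: filt_tens. Qed.

Lemma tens_structc_gr (g : structc R I) (h : structc R J) :
  sfilt w g -> sfilt v h ->
  tens_structc (sgr w g) (sgr v h) = sgr (wprod w v) (tens_structc g h).
Proof.
move=> hg hh; apply/funext => p; apply/funext => q.
by rewrite tens_structcE tens_gr// /sgr tens_structcE /wprod addrACA.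
Qed.

End Graded_tensor.

Lemma tens_monom (R : realType) (I J : choiceType) (l : I) (m : J) :
  tens (monom R l) (monom R m) = monom R (l, m).
Proof.
apply: seriesP => N [p q]; rewrite /tens /monom /= xpair_eqE.
rewrite big_ord_recl big1 ?addr0 => [|i _]; last by rewrite mul0r.
by rewrite /= subn0; do 3!case: eqP => _; rewrite ?(mul0r, mulr0, mulr1).
Qed.

(** * The associated graded of a filtered bialgebra *)

Section Graded_hopf.
Variables (R : realType) (Q : hopf_data R) (s : int * int * int * int).

Definition wt (m : mono) : int :=
  s.1.1.1 *+ m.1.1.1 + s.1.1.2 *+ m.1.1.2 + s.1.2 *+ m.1.2 + s.2 *+ m.2.

Lemma wt0 : wt mono0 = 0.
Proof. by rewrite /wt !mulr0n !addr0. Qed.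

Definition hfilt : Prop :=
  sfilt wt (prodc Q) /\ forall m, filt (wprod wt wt) (wt m) (copc Q m).

Definition hgr : hopf_data R :=
  HopfData (sgr wt (prodc Q)) (fun m => gr (wprod wt wt) (wt m) (copc Q m)).

Lemma cop_eq0 (P : hopf_data R) x N p :
  (forall i m, (i <= N)%N -> x i m * copc P m (N - i)%N p = 0) -> cop P x N p = 0.
Proof.
move=> h; apply: big1 => i _; apply: fsbig1 => m _; apply: h.
by have := ltn_ord i; lia.
Qed.

Lemma cop_monomE (P : hopf_data R) m : cop P (monom R m) = copc P m.
Proof.
apply: seriesP => N p; rewrite /cop (sum_ord_single (i0 := ord0)) => [|i i0].
  rewrite (fsbig_single (i0 := m)) /monom /= ?eqxx ?mul1r ?subn0// => l /negPf->.
  by rewrite mul0r.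
apply: fsbig1 => l _; rewrite /monom (_ : (_ == 0)%N = false) ?mul0r//.
by apply: contraNF i0 => /eqP i0; apply/eqP/val_inj.
Qed.

Hypothesis hQ : hfilt.

Lemma filt_cop d x : filt wt d x -> filt (wprod wt wt) d (cop Q x).
Proof.
move=> hx N p; apply: contraNT; rewrite -ltNge => lt_p.
apply/eqP/cop_eq0 => i m iN; apply/eqP; apply: contraTT lt_p.
rewrite mulf_eq0 negb_or => /andP[/hx xn /(proj2 hQ) cn]; rewrite -leNgt.
by lia.
Qed.

Lemma cop_gr d x : filt wt d x ->
  cop hgr (gr wt d x) = gr (wprod wt wt) d (cop Q x).
Proof.
move=> hx; apply: seriesP => N p; rewrite {2}/gr; case: eqP => wp.
  apply: eq_bigr => i _; apply: eq_fsbigr => m _; rewrite /= /gr.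
  have [x0|/hx xn] := eqVneq (x i m) 0; first by rewrite x0 if_same !mul0r.
  have [c0|/(proj2 hQ) cn] := eqVneq (copc Q m (N - i)%N p) 0.
    by rewrite c0 if_same !mulr0.
  by rewrite !ifT//; apply/eqP; have := ltn_ord i; lia.
apply: cop_eq0 => i m iN; rewrite /= /gr.
case: eqP => xi; rewrite ?mul0r//; case: eqP => yj; rewrite ?mulr0//.
by exfalso; apply: wp; lia.
Qed.

(** By [mul_gr] and [cop_gr], both sides of each axiom are the parts of one common weight of the
    corresponding sides for [Q]. *)
Lemma bialgebra_hgr : bialgebra Q -> bialgebra hgr.
Proof.
have [hg hc] := hQ.
have fm m : filt wt (wt m) (monom R m) by exact: filt_monom.
have mulm l m : mul (prodc hgr) (monom R l) (monom R m) =
    gr wt (wt l + wt m) (mul (prodc Q) (monom R l) (monom R m)).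
  by rewrite -mul_gr// !gr_monom.
case=> m1l m1r mA ord c1 cM cA ul ur; split.
- by move=> m; rewrite mulm m1l wt0 add0r gr_monom.
- by move=> m; rewrite mulm m1r wt0 addr0 gr_monom.
- move=> k l m; rewrite !mulm -[in LHS](gr_monom R wt k) -[in RHS](gr_monom R wt m).
  rewrite mul_gr//; last exact: filt_mul.
  by rewrite mul_gr//; [rewrite mA addrA|exact: filt_mul].
- move=> i j k l; pose e1 : mono := (1, 0, 0, 0)%N; pose e2 : mono := (0, 1, 0, 0)%N.
  pose e3 : mono := (0, 0, 1, 0)%N; pose e4 : mono := (0, 0, 0, 1)%N.
  have powm m n : pow (prodc hgr) (monom R m) n =
      gr wt (wt m *+ n) (pow (prodc Q) (monom R m) n).
    by rewrite -{1}(gr_monom R wt m) (pow_gr wt0).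
  have fp m n : filt wt (wt m *+ n) (pow (prodc Q) (monom R m) n).
    exact: (filt_pow wt0).
  rewrite !powm !mul_gr//; do ?by do ?apply: filt_mul.
  rewrite ord -{2}(gr_monom R wt (i, j, k, l)); congr gr.
  by rewrite /wt /= !mulr0n !mulr1n !addr0 !add0r.
- rewrite cop_monomE -[RHS](gr_monom R (wprod wt wt)) -c1 cop_monomE /= /wprod.
  by rewrite /= !wt0.
- move=> l m; rewrite mulm cop_gr ?cM; last exact: filt_mul.
  have ff k : filt (wprod wt wt) (wt k) (cop Q (monom R k)) by exact: filt_cop.
  rewrite -mul_gr//; last exact: sfilt_tens_structc.
  by rewrite -tens_structc_gr// -!cop_gr// !gr_monom.
(* Coassociativity is stated on coefficients. If the output has the weight of [m], every nonzero
   term attains its bounds, so grading removes nothing and the axiom for [Q] applies. *)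
- move=> m N k l r; have [wm|wm] := eqVneq (wt k + wt l + wt r) (N%:Z + wt m).
    rewrite [LHS](_ : _ = \sum_(i < N.+1) \sum_(t \in [set: mono])
      copc Q m i (t, r) * copc Q t (N - i)%N (k, l)).
      rewrite cA; apply: eq_bigr => i _; apply: eq_fsbigr => t _.
      rewrite /= /gr; have [x0|/hc xn] := eqVneq (copc Q m i (k, t)) 0.
        by rewrite x0 if_same !mul0r.
      have [c0|/hc cn] := eqVneq (copc Q t (N - i)%N (l, r)) 0.
        by rewrite c0 if_same !mulr0.
      rewrite !ifT//; apply/eqP; move: xn cn; rewrite /wprod /=; have := ltn_ord i; lia.
    apply: eq_bigr => i _; apply: eq_fsbigr => t _.
    rewrite /= /gr; have [x0|/hc xn] := eqVneq (copc Q m i (t, r)) 0.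
      by rewrite x0 if_same !mul0r.
    have [c0|/hc cn] := eqVneq (copc Q t (N - i)%N (k, l)) 0.
      by rewrite c0 if_same !mulr0.
    rewrite !ifT//; apply/eqP; move: xn cn; rewrite /wprod /=; have := ltn_ord i; lia.
  (* Otherwise both sides vanish, since a surviving term would force the weights to agree. *)
  rewrite !big1// => i _; apply: fsbig1 => t _; rewrite /= /gr /wprod /=;
    case: eqP => w1; rewrite ?mul0r//; case: eqP => w2; rewrite ?mulr0//;
    exfalso; apply: (negP wm); apply/eqP; have := ltn_ord i; lia.
- move=> m N l; rewrite /= /gr /wprod /= wt0 add0r ul.
  by rewrite -[RHS](congr1 (fun x => x N l) (gr_monom R wt m)).
- move=> m N l; rewrite /= /gr /wprod /= wt0 addr0 ur.
  by rewrite -[RHS](congr1 (fun x => x N l) (gr_monom R wt m)).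
Qed.

Lemma alg_finite_hgr : alg_finite Q -> alg_finite hgr.
Proof.
have grn (J : choiceType) (v : J -> int) d (x : series R J) N l :
    gr v d x N l != 0 -> x N l != 0 by rewrite /gr; case: ifP => //; rewrite eqxx.
move=> [fg fc]; split=> [m n N|m N].
  by apply: sub_finite_set (fg m n N) => l /grn.
by apply: sub_finite_set (fc m N) => l /grn.
Qed.

Lemma grp_finite_hgr : grp_finite Q -> grp_finite hgr.
Proof.
have grn (J : choiceType) (v : J -> int) d (x : series R J) N l :
    gr v d x N l != 0 -> x N l != 0 by rewrite /gr; case: ifP => //; rewrite eqxx.
move=> [fg fc]; split=> [N l|N p].
  by apply: sub_finite_set (fg N l) => q /grn.
by apply: sub_finite_set (fc N p) => m /grn.
Qed.

End Graded_hopf.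

Section Scaling.
Variables (R : realType) (I : choiceType).
Implicit Types (x y : series R I) (g : structc R I).

Lemma mulZZ g a b x y : mul g (a *: x) (b *: y) = (a * b) *: mul g x y.
Proof.
apply: seriesP => N l; rewrite seriesZ /mul mulr_sumr; apply: eq_bigr => i _.
rewrite mulr_sumr; apply: eq_bigr => j _.
rewrite mulr_fsumr; apply: eq_fsbigr => p _; rewrite !seriesZ.
by rewrite (mulrACA a) !mulrA.
Qed.

End Scaling.

(** Each case adds one generator at the left end of an ordered monomial, so that no reordering is
    involved. *)
Lemma mono_ind (P : mono -> Prop) : P mono0 ->
  (forall i j k l : nat, P (i, j, k, l) -> P (i.+1, j, k, l)) ->
  (forall j k l : nat, P (0, j, k, l)%N -> P (0, j.+1, k, l)%N) ->
  (forall k l : nat, P (0, 0, k, l)%N -> P (0, 0, k.+1, l)%N) ->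
  (forall l : nat, P (0, 0, 0, l)%N -> P (0, 0, 0, l.+1)%N) ->
  forall m, P m.
Proof.
move=> P0 P1 P2 P3 P4 [[[i j] k] l]; elim: i => [|i]; last exact: P1.
elim: j => [|j]; last exact: P2.
elim: k => [|k]; last exact: P3.
by elim: l => [|l]; last exact: P4.
Qed.

(** * The filtration of a quantum group *)

Section Ordered_products.
Variables (R : realType) (Q : hopf_data R).
Hypothesis bQ : bialgebra Q.
Local Notation g := (prodc Q).

Lemma mul_onel x : mul g (monom R mono0) x = x.
Proof. exact/monom1l/bialg_mul1l. Qed.

Lemma mul_oner x : mul g x (monom R mono0) = x.
Proof. exact/monom1r/bialg_mul1r. Qed.

Lemma pow_X1 n : pow g (X1 R) n = monom R (n, 0, 0, 0)%N.
Proof. by rewrite -(bialg_ordered bQ) /= !mul_oner. Qed.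

Lemma pow_X2 n : pow g (X2 R) n = monom R (0, n, 0, 0)%N.
Proof. by rewrite -(bialg_ordered bQ) /= !mul_oner mul_onel. Qed.

Lemma pow_X3 n : pow g (X3 R) n = monom R (0, 0, n, 0)%N.
Proof. by rewrite -(bialg_ordered bQ) /= !mul_oner !mul_onel. Qed.

Lemma pow_X4 n : pow g (X4 R) n = monom R (0, 0, 0, n)%N.
Proof. by rewrite -(bialg_ordered bQ) /= !mul_onel. Qed.

Lemma mul_X12 i j :
  mul g (monom R (i, 0, 0, 0)%N) (monom R (0, j, 0, 0)%N) = monom R (i, j, 0, 0)%N.
Proof. by rewrite -pow_X1 -pow_X2 -(bialg_ordered bQ) /= !mul_oner. Qed.

Lemma mul_X123 i j k :
  mul g (monom R (i, j, 0, 0)%N) (monom R (0, 0, k, 0)%N) = monom R (i, j, k, 0)%N.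
Proof.
by rewrite -mul_X12 -pow_X1 -pow_X2 -pow_X3 -(bialg_ordered bQ) /= !mul_oner.
Qed.

Lemma mul_X1234 i j k l :
  mul g (monom R (i, j, k, 0)%N) (monom R (0, 0, 0, l)%N) = monom R (i, j, k, l).
Proof.
by rewrite -mul_X123 -mul_X12 -pow_X1 -pow_X2 -pow_X3 -pow_X4 -(bialg_ordered bQ).
Qed.

(** The product is associative and [X1] comes first in the ordering, so the result is already
    ordered. The analogues for the other generators require that no earlier generator occurs. *)
Lemma mul_X1 i j k l : mul g (X1 R) (monom R (i, j, k, l)) = monom R (i.+1, j, k, l).
Proof.
have h1 : mul g (X1 R) (monom R (i, 0, 0, 0)%N) = monom R (i.+1, 0, 0, 0)%N.
  by rewrite -!pow_X1.
have h2 : mul g (X1 R) (monom R (i, j, 0, 0)%N) = monom R (i.+1, j, 0, 0)%N.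
  by rewrite -(mul_X12 i) (bialg_mulA bQ) h1 mul_X12.
have h3 : mul g (X1 R) (monom R (i, j, k, 0)%N) = monom R (i.+1, j, k, 0)%N.
  by rewrite -(mul_X123 i) (bialg_mulA bQ) h2 mul_X123.
by rewrite -(mul_X1234 i) (bialg_mulA bQ) h3 mul_X1234.
Qed.

Lemma mul_X2 j k l :
  mul g (X2 R) (monom R (0, j, k, l)%N) = monom R (0, j.+1, k, l)%N.
Proof.
have h2 : mul g (X2 R) (monom R (0, j, 0, 0)%N) = monom R (0, j.+1, 0, 0)%N.
  by rewrite -!pow_X2.
have h3 : mul g (X2 R) (monom R (0, j, k, 0)%N) = monom R (0, j.+1, k, 0)%N.
  by rewrite -(mul_X123 0 j) (bialg_mulA bQ) h2 mul_X123.
by rewrite -(mul_X1234 0 j) (bialg_mulA bQ) h3 mul_X1234.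
Qed.

Lemma mul_X3 k l : mul g (X3 R) (monom R (0, 0, k, l)%N) = monom R (0, 0, k.+1, l)%N.
Proof.
have h3 : mul g (X3 R) (monom R (0, 0, k, 0)%N) = monom R (0, 0, k.+1, 0)%N.
  by rewrite -!pow_X3.
by rewrite -(mul_X1234 0 0 k) (bialg_mulA bQ) h3 mul_X1234.
Qed.

Lemma mul_X4 l : mul g (X4 R) (monom R (0, 0, 0, l)%N) = monom R (0, 0, 0, l.+1)%N.
Proof. by rewrite -!pow_X4. Qed.

End Ordered_products.

(** * Filtered products from commutators of generators *)

Section Filtered_by_commutators.
Variables (R : realType) (Q : hopf_data R) (s : int * int * int * int).
Hypothesis bQ : bialgebra Q.
Hypothesis fQ : forall N l, finite_set [set p : mono * mono | prodc Q p.1 p.2 N l != 0].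
Local Notation g := (prodc Q).
Local Notation w := (wt s).

Let e1 : mono := (1, 0, 0, 0)%N.
Let e2 : mono := (0, 1, 0, 0)%N.
Let e3 : mono := (0, 0, 1, 0)%N.
Let e4 : mono := (0, 0, 0, 1)%N.

Let w1 i j k l : w (i.+1, j, k, l) = w e1 + w (i, j, k, l).
Proof. by rewrite /wt /= !mulr0n !mulr1n mulrS; ring. Qed.
Let w2 i j k l : w (i, j.+1, k, l) = w e2 + w (i, j, k, l).
Proof. by rewrite /wt /= !mulr0n !mulr1n mulrS; ring. Qed.
Let w3 i j k l : w (i, j, k.+1, l) = w e3 + w (i, j, k, l).
Proof. by rewrite /wt /= !mulr0n !mulr1n mulrS; ring. Qed.
Let w4 i j k l : w (i, j, k, l.+1) = w e4 + w (i, j, k, l).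
Proof. by rewrite /wt /= !mulr0n !mulr1n mulrS; ring. Qed.

(** The coproduct is multiplicative and every monomial is built by left multiplication by
    generators, so the bound spreads from the generators. *)
Lemma hfilt_cop_gens : sfilt w g ->
  filt (wprod w w) (w e1) (cop Q (X1 R)) -> filt (wprod w w) (w e2) (cop Q (X2 R)) ->
  filt (wprod w w) (w e3) (cop Q (X3 R)) -> filt (wprod w w) (w e4) (cop Q (X4 R)) ->
  hfilt Q s.
Proof.
move=> hg c1 c2 c3 c4; split=> // m; rewrite -cop_monomE.
have hgg := sfilt_tens_structc hg hg.
elim/mono_ind: m => [|i j k l IH|j k l IH|k l IH|l IH].
- have := @filt_monom R _ (wprod w w) (mono0, mono0).
  by rewrite (bialg_cop1 bQ) /wprod /= !wt0.
- by rewrite -(mul_X1 bQ) (bialg_copM bQ) w1; exact: filt_mul.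
- by rewrite -(mul_X2 bQ) (bialg_copM bQ) w2; exact: filt_mul.
- by rewrite -(mul_X3 bQ) (bialg_copM bQ) w3; exact: filt_mul.
- by rewrite -(mul_X4 bQ) (bialg_copM bQ) w4; exact: filt_mul.
Qed.

(** The shift by 1 compensates the weight -1 of alpha, so the commutator itself has weight at most
    [w a + w b]. The explicit factor alpha expresses commutativity modulo alpha. *)
Definition comm_filt (a b : mono) : Prop := exists2 z,
  comm g (monom R a) (monom R b) = alpha_mul z & filt w (w a + w b + 1) z.

Section Order_step.
Variable K : nat.
Hypothesis hK : forall m n, filt_mod w K (w m + w n) (g m n).

Let leftf a m := filt_mod w K.+1 (w a + w m) (mul g (monom R a) (monom R m)).

(** The left factor is a single monomial of order 0, so only the constants [g a m] enter. For these
    order K + 1 is assumed, whereas [hK] reaches only order K. *)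
Let leftf_mul a d x : (forall m, leftf a m) -> filt_mod w K.+1 d x ->
  filt_mod w K.+1 (w a + d) (mul g (monom R a) x).
Proof.
move=> ha hx N l NK; apply: contraNT; rewrite -ltNge => lt_l.
apply/eqP/mul_eq0 => i j p ijN; apply/eqP; apply: contraTT lt_l.
rewrite !mulf_eq0 !negb_or => /andP[/andP[an xn] gn]; rewrite -leNgt.
have [i0 pa] : i = 0%N /\ p.1 = a.
  move: an; rewrite /monom; have [->|] := eqVneq i 0%N; last by rewrite eqxx.
  by have [->|] := eqVneq p.1 a; last by rewrite eqxx.
move: gn; rewrite pa -mul_monomE => /ha; have := hx _ _ _ xn.
by lia.
Qed.

(* A commutator is alpha times a series, so here the filtration is needed only
   modulo alpha^K, one order lower than the conclusion. *)
Let leftf_swap a b m : comm_filt b a -> (forall m, leftf a m) -> leftf b m ->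
  filt_mod w K.+1 (w b + (w a + w m)) (mul g (monom R b) (mul g (monom R a) (monom R m))).
Proof.
move=> [z zE hz] ha hb.
rewrite (bialg_mulA bQ).
(* With b, a, m for the monomials, b a m is split as (b a - a b) m + a b m; the first summand is
   alpha times [z] m. *)
rewrite -[X in filt_mod _ _ _ X](subrK (mul g (mul g (monom R a) (monom R b)) (monom R m))).
rewrite -(mulBl fQ) [X in mul _ X _]zE mul_alphal -(opprK (mul _ (mul _ _ _) _)).
apply: filt_modB.
  apply: filt_mod_alpha_mul.
  rewrite (_ : _ + 1 = (w b + w a + 1) + w m); last by ring.
  apply: filt_mod_mul => //; first exact: filt_filt_mod.
  exact/filt_filt_mod/filt_monom.
apply: filt_modN; rewrite -(bialg_mulA bQ) addrCA; exact: leftf_mul ha hb.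
Qed.

Hypotheses (c21 : comm_filt e2 e1) (c31 : comm_filt e3 e1) (c41 : comm_filt e4 e1)
  (c32 : comm_filt e3 e2) (c42 : comm_filt e4 e2) (c43 : comm_filt e4 e3).

Let fm m : filt_mod w K.+1 (w m) (monom R m).
Proof. exact/filt_filt_mod/filt_monom. Qed.

Let leftf1 m : leftf e1 m.
Proof. by case: m => [[[i j] k] l]; rewrite /leftf (mul_X1 bQ) -w1. Qed.

(** By induction on the exponents, the generator is swapped past the earlier generators until it
    reaches its place. The next two lemmas proceed likewise. *)
Let leftf2 m : leftf e2 m.
Proof.
case: m => [[[i j] k] l]; rewrite /leftf; elim: i => [|i IHi].
  by rewrite (mul_X2 bQ) -w2.
by rewrite -(mul_X1 bQ) w1; exact: leftf_swap.
Qed.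

Let leftf3 m : leftf e3 m.
Proof.
case: m => [[[i j] k] l]; rewrite /leftf; elim: i => [|i IHi]; last first.
  by rewrite -(mul_X1 bQ) w1; exact: leftf_swap.
elim: j => [|j IHj]; first by rewrite (mul_X3 bQ) -w3.
by rewrite -(mul_X2 bQ) w2; exact: leftf_swap.
Qed.

Let leftf4 m : leftf e4 m.
Proof.
case: m => [[[i j] k] l]; rewrite /leftf; elim: i => [|i IHi]; last first.
  by rewrite -(mul_X1 bQ) w1; exact: leftf_swap.
elim: j => [|j IHj]; last by rewrite -(mul_X2 bQ) w2; exact: leftf_swap.
elim: k => [|k IHk]; first by rewrite (mul_X4 bQ) -w4.
by rewrite -(mul_X3 bQ) w3; exact: leftf_swap.
Qed.

Lemma filt_mod_succ m n : filt_mod w K.+1 (w m + w n) (g m n).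
Proof.
rewrite -mul_monomE; elim/mono_ind: m => [|i j k l IH|j k l IH|k l IH|l IH].
- by rewrite (bialg_mul1l bQ) wt0 add0r.
- by rewrite -(mul_X1 bQ) -(bialg_mulA bQ) w1 -addrA; exact: leftf_mul.
- by rewrite -(mul_X2 bQ) -(bialg_mulA bQ) w2 -addrA; exact: leftf_mul.
- by rewrite -(mul_X3 bQ) -(bialg_mulA bQ) w3 -addrA; exact: leftf_mul.
- by rewrite -(mul_X4 bQ) -(bialg_mulA bQ) w4 -addrA; exact: leftf_mul.
Qed.

End Order_step.

Lemma sfilt_comm_gens : comm_filt e2 e1 -> comm_filt e3 e1 -> comm_filt e4 e1 ->
  comm_filt e3 e2 -> comm_filt e4 e2 -> comm_filt e4 e3 -> sfilt w g.
Proof.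
move=> c21 c31 c41 c32 c42 c43 m n; apply: filtW => K.
(* For K = 0 the condition is empty. *)
by elim: K m n => [//|K IHK] m n; exact: filt_mod_succ.
Qed.

End Filtered_by_commutators.

(** * Duality *)

Section Duality.
Variable R : realType.

Lemma pairing_monoml (I : choiceType) (w : I -> R) m (x : series R I) N :
  pairing w (monom R m) x N = w m * x N m.
Proof.
rewrite /pairing (sum_ord_single (i0 := ord0)) => [|i i0].
  rewrite (fsbig_single (i0 := m)) /monom /= ?eqxx ?subn0 ?mulr1// => l /negPf->.
  by rewrite mulr0 mul0r.
apply: fsbig1 => l _; rewrite /monom (_ : (_ == 0)%N = false) ?mulr0 ?mul0r//.
by apply: contraNF i0 => /eqP i0; apply/eqP/val_inj.
Qed.

Lemma pairing_monomr (I : choiceType) (w : I -> R) m (x : series R I) N :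
  pairing w x (monom R m) N = w m * x N m.
Proof.
(* The monomial in the second argument has order 0, so the first argument carries the full order
   N. *)
rewrite /pairing (sum_ord_single (i0 := ord_max)) => [|i iN].
  rewrite (fsbig_single (i0 := m)) /monom /= ?eqxx ?subnn ?mulr1// => l /negPf->.
  by rewrite mulr0.
apply: fsbig1 => l _; rewrite /monom (_ : (_ == 0)%N = false) ?mulr0//.
apply: contraNF iN => /eqP iN; apply/eqP/val_inj => /=; have := ltn_ord i; lia.
Qed.

(** Pairing with a monomial extracts one coefficient times a factorial, so duality amounts to
    equalities between structure constants. *)
Lemma dual_pairP (G U : hopf_data R) : dual_pair G U <->
  (forall l m n N, mono_fact R n * prodc G l m N n =
    mono_fact R l * mono_fact R m * copc U n N (l, m)) /\
  (forall l m n N, mono_fact R n * prodc U l m N n =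
    mono_fact R l * mono_fact R m * copc G n N (l, m)).
Proof.
split=> -[h1 h2]; split=> l m n.
- move=> N; have := congr1 (fun f => f N) (h1 l m n).
  by rewrite /pair1 /pair2 tens_monom pairing_monomr pairing_monoml cop_monomE mul_monomE.
- move=> N; have := congr1 (fun f => f N) (h2 l m n).
  by rewrite /pair1 /pair2 tens_monom pairing_monomr pairing_monoml cop_monomE mul_monomE.
- apply/funext => N; rewrite /pair1 /pair2 tens_monom pairing_monomr.
  by rewrite pairing_monoml cop_monomE mul_monomE h1.
- apply/funext => N; rewrite /pair1 /pair2 tens_monom pairing_monomr.
  by rewrite pairing_monoml cop_monomE mul_monomE h2.
Qed.

Lemma mono_fact_neq0 m : mono_fact R m != 0.
Proof. by rewrite /mono_fact pnatr_eq0 -lt0n !muln_gt0 !fact_gt0. Qed.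

Section Dual_weights.
Variables (G U : hopf_data R) (s t : int * int * int * int).
Hypothesis st : forall m, wt t m = - wt s m.
Hypothesis dGU : dual_pair G U.

Let prodG0 l m n N : (prodc G l m N n != 0) = (copc U n N (l, m) != 0).
Proof.
have /(congr1 (fun a : R => a != 0)) := (proj1 (dual_pairP G U) dGU).1 l m n N.
by rewrite !mulf_eq0 !negb_or !mono_fact_neq0.
Qed.

Let prodU0 l m n N : (prodc U l m N n != 0) = (copc G n N (l, m) != 0).
Proof.
have /(congr1 (fun a : R => a != 0)) := (proj1 (dual_pairP G U) dGU).2 l m n N.
by rewrite !mulf_eq0 !negb_or !mono_fact_neq0.
Qed.

(** A product constant of one side is nonzero exactly when the dual coproduct constant is. Duality
    exchanges inputs and output, and the sign change of the weights turns the bound around again. *)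
Lemma dual_hfilt : hfilt G t -> hfilt U s.
Proof.
move=> [hg hc]; split=> [m n N l|m N [k l]].
  by rewrite prodU0 => /hc; rewrite /wprod /= !st; lia.
by rewrite -prodG0 => /hg; rewrite /wprod /= !st; lia.
Qed.

(** The two weight conditions that select the surviving constants are equivalent, so dual constants
    are kept or dropped together. *)
Lemma dual_hgr : dual_pair (hgr G t) (hgr U s).
Proof.
have [h1 h2] := proj1 (dual_pairP G U) dGU.
apply/dual_pairP; split=> l m n N; rewrite /= /sgr /gr /wprod /= !st.
  rewrite (_ : (- wt s n == _) = (wt s l + wt s m == N%:Z + wt s n)).
    by case: eqP => // _; rewrite !mulr0.
  by apply/eqP/eqP; lia.
rewrite (_ : (- wt s l + _ == _) = (wt s n == N%:Z + (wt s l + wt s m))).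
  by case: eqP => // _; rewrite !mulr0.
by apply/eqP/eqP; lia.
Qed.

End Dual_weights.
End Duality.

(** * Galilei relations *)

Section Power_series_in_X4.
Variables (R : realType) (Q : hopf_data R).
Hypothesis bQ : bialgebra Q.
Local Notation g := (prodc Q).

(** The series of f(n) X4^n without alpha: powers of [X4] are basis monomials, so cosh and sinh of
    [X4] have explicit coefficients. *)
Definition X4_series (f : nat -> R) : series R mono :=
  fun N m => if (N == 0%N) && (m.1 == (0, 0, 0)%N) then f m.2 else 0.

Lemma powZ a x n : pow g (a *: x) n = a ^+ n *: pow g x n.
Proof.
elim: n => [|n IHn]; first by rewrite expr0 scale1r.
by rewrite /= IHn mulZZ exprS.
Qed.

Lemma fexp_X4 a : fexp g (a *: X4 R) = X4_series (fun n => a ^+ n / n`!%:R).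
Proof.
apply: seriesP => N [m n]; rewrite /fexp /fsum (fsbig_single (i0 := n)) => [|k kn].
  rewrite powZ pow_X4// !seriesZ /monom xpair_eqE eqxx andbT /X4_series /=.
  by case: ifP => _; rewrite ?mulr1 ?mulr0// mulrC.
by rewrite powZ pow_X4// !seriesZ /monom xpair_eqE (eq_sym n) (negPf kn) !andbF !mulr0.
Qed.

Lemma X4_seriesD f h : X4_series f + X4_series h = X4_series (fun n => f n + h n).
Proof.
by apply: seriesP => N m; rewrite seriesD /X4_series; case: ifP; rewrite ?addr0.
Qed.

Lemma X4_seriesZ a f : a *: X4_series f = X4_series (fun n => a * f n).
Proof.
by apply: seriesP => N m; rewrite seriesZ /X4_series; case: ifP; rewrite ?mulr0.
Qed.

Lemma X4_seriesN f : - X4_series f = X4_series (fun n => - f n).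
Proof.
by apply: seriesP => N m; rewrite seriesN /X4_series; case: ifP; rewrite ?oppr0.
Qed.

Lemma X4_series_monom k : monom R (0, 0, 0, k)%N = X4_series (fun n => (n == k)%:R).
Proof.
apply: seriesP => N [m n]; rewrite /monom /X4_series xpair_eqE /=.
by case: (N == 0%N); case: (m == _); case: (n == k).
Qed.

Lemma fcosh_X4 :
  fcosh g (X4 R) = X4_series (fun n => 2^-1 * (1 + (-1) ^+ n) / n`!%:R).
Proof.
rewrite /fcosh -[- X4 R]scaleN1r -[X in fexp _ X + _]scale1r !fexp_X4.
rewrite X4_seriesD X4_seriesZ; congr X4_series; apply/funext => n.
by rewrite expr1n -mulrDl mulrA.
Qed.

Lemma fsinh_X4 :
  fsinh g (X4 R) = X4_series (fun n => 2^-1 * (1 - (-1) ^+ n) / n`!%:R).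
Proof.
rewrite /fsinh -[- X4 R]scaleN1r -[X in fexp _ X + _]scale1r !fexp_X4.
rewrite X4_seriesN X4_seriesD X4_seriesZ.
congr X4_series; apply/funext => n.
by rewrite expr1n -mulrBl mulrA.
Qed.

Lemma fcosh_X4_sub1 : fcosh g (X4 R) - monom R mono0 =
  X4_series (fun n => if n is 0 then 0 else 2^-1 * (1 + (-1) ^+ n) / n`!%:R).
Proof.
rewrite fcosh_X4 (X4_series_monom 0) X4_seriesN X4_seriesD.
(* Subtracting 1 cancels the constant coefficient of cosh. *)
congr X4_series; apply/funext => -[|n]; last by rewrite oppr0 addr0.
by rewrite /= expr0 fact0; field.
Qed.

Section Weight.
Variable s : int * int * int * int.
Hypothesis s4 : s.2 = -1.

Let wt4 n : wt s (0, 0, 0, n)%N = - n%:Z.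
Proof. by rewrite /wt /= !mulr0n s4 !add0r mulNrn natz. Qed.

(** As [X4] has weight -1, vanishing below degree k is the same as weight at most -k, and the top
    part is then the leading term. *)
Lemma filt_X4_series k f : (forall n, (n < k)%N -> f n = 0) ->
  filt (wt s) (- k%:Z) (X4_series f).
Proof.
move=> f0 N [m n]; rewrite /X4_series /=; case: ifP => [|_]; last by rewrite eqxx.
case/andP => /eqP-> /eqP->; rewrite wt4; case: (ltnP n k) => [/f0->|]; last by lia.
by rewrite eqxx.
Qed.

Lemma gr_X4_series k f :
  gr (wt s) (- k%:Z) (X4_series f) = f k *: monom R (0, 0, 0, k)%N.
Proof.
rewrite X4_series_monom X4_seriesZ; apply: seriesP => N [m n].
rewrite /gr /X4_series /=; case: (eqVneq N 0%N) => [->|_] /=; last by rewrite if_same.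
case: (eqVneq m (0, 0, 0)%N) => [->|_] /=; last by rewrite if_same.
rewrite wt4 add0r eqr_opp eqz_nat.
by case: (eqVneq n k) => [->|_]; rewrite ?mulr1 ?mulr0.
Qed.

End Weight.
End Power_series_in_X4.

Section Signs.
Variables (R : realType) (I : choiceType).
Implicit Types (x y : series R I) (g : structc R I).

Lemma commC g x y : comm g x y = - comm g y x.
Proof. by rewrite /comm opprB. Qed.

Lemma alpha_mulN x : alpha_mul (- x) = - alpha_mul x.
Proof. by apply: seriesP => -[|N] m; rewrite seriesN /= ?oppr0. Qed.

Lemma alpha_mulZ a x : alpha_mul (a *: x) = a *: alpha_mul x.
Proof. by apply: seriesP => -[|N] m; rewrite seriesZ /= ?mulr0. Qed.

Lemma alpha_mul0 : alpha_mul 0 = 0 :> series R I.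
Proof. by apply: seriesP => -[|N] m. Qed.

Lemma alpha_div0 : alpha_div 0 = 0 :> series R I.
Proof. by apply: seriesP. Qed.

Lemma tensZl (J : choiceType) a x (y : series R J) :
  tens (a *: x) y = a *: tens x y.
Proof.
apply: seriesP => N p; rewrite seriesZ /tens mulr_sumr.
by apply: eq_bigr => i _; rewrite seriesZ mulrA.
Qed.

End Signs.

(** * The contracted quantum group *)

Section Contracted_group.
Variables (R : realType) (G : hopf_data R).
Hypotheses (hG : quantum_group G) (relG : poincare_group G).

Definition group_wt : int * int * int * int := (-2, 0, -1, -1).

Local Notation g := (prodc G).
Local Notation w := (wt group_wt).
Local Notation w2 := (wprod w w).
Local Notation one := (monom R mono0).
Local Notation ch := (fcosh g (X4 R)).
Local Notation sh := (fsinh g (X4 R)).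

Let bG : bialgebra G := proj2 hG.

Let f0 : filt w 0 one. Proof. exact: filt_monom. Qed.
Let f1 : filt w (- 2) (X1 R). Proof. exact: filt_monom. Qed.
Let f2 : filt w 0 (X2 R). Proof. exact: filt_monom. Qed.
Let f3 : filt w (- 1) (X3 R). Proof. exact: filt_monom. Qed.
Let f4 : filt w (- 1) (X4 R). Proof. exact: filt_monom. Qed.

Let g0 : gr w 0 one = one. Proof. exact: (gr_monom R w mono0). Qed.
Let g1 : gr w (- 2) (X1 R) = X1 R. Proof. exact: (gr_monom R w (1, 0, 0, 0)%N). Qed.
Let g2 : gr w 0 (X2 R) = X2 R. Proof. exact: (gr_monom R w (0, 1, 0, 0)%N). Qed.
Let g3 : gr w (- 1) (X3 R) = X3 R. Proof. exact: (gr_monom R w (0, 0, 1, 0)%N). Qed.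
Let g4 : gr w (- 1) (X4 R) = X4 R. Proof. exact: (gr_monom R w (0, 0, 0, 1)%N). Qed.

Let f_ch1 : filt w (- 2) (ch - one).
Proof.
(* The linear coefficient of cosh vanishes, so cosh - 1 starts in degree 2. *)
rewrite fcosh_X4_sub1//; apply: (@filt_X4_series _ _ _ 2%N) => // -[|[|n]]// _.
by rewrite expr1 subrr mulr0 mul0r.
Qed.

Let gr_ch1 : gr w (- 2) (ch - one) = 2^-1 *: monom R (0, 0, 0, 2)%N.
Proof.
rewrite fcosh_X4_sub1// (@gr_X4_series _ _ _ 2%N)//; congr (_ *: _).
by rewrite (_ : 2`! = 2%N)//; field.
Qed.

Let f_ch : filt w 0 ch.
Proof. by rewrite fcosh_X4//; exact: (@filt_X4_series _ _ _ 0%N). Qed.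

Let gr_ch : gr w 0 ch = one.
Proof.
rewrite fcosh_X4// (@gr_X4_series _ _ _ 0%N)// expr0 fact0.
by rewrite (_ : _ / _ = 1) ?scale1r//; field.
Qed.

Let f_sh : filt w (- 1) sh.
Proof.
rewrite fsinh_X4//; apply: (@filt_X4_series _ _ _ 1%N) => // -[|]// _.
by rewrite expr0 subrr mulr0 mul0r.
Qed.

Let gr_sh : gr w (- 1) sh = X4 R.
Proof.
rewrite fsinh_X4// (@gr_X4_series _ _ _ 1%N)// expr1.
by rewrite (_ : _ / _ = 1) ?scale1r//; rewrite (_ : 1`! = 1%N)//; field.
Qed.

Let f2_le d e f (x y : series R mono) : d + e <= f ->
  filt w d x -> filt w e y -> filt w2 f (tens x y).
Proof. by move=> def hx hy; apply: filt_le def _; exact: filt_tens. Qed.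

(** The bounds on generators are read off the relations. They are strict for [a0, a1] and [chi, a0],
    whose contractions therefore vanish. *)
Lemma group_hfilt : hfilt G group_wt.
Proof.
have [[finG _] _] := hG.
have [[c1 c2 c3 c4] [[r23 r12 r13] [r41 r42 r43]]] := relG.
apply: hfilt_cop_gens => //.
- apply: sfilt_comm_gens => //.
  + by exists 0; [rewrite commC [comm _ _ _]r12 alpha_mul0 oppr0|exact: filt0].
  + exists (- X1 R); first by rewrite commC [comm _ _ _]r13 alpha_mulN.
    by apply/filtN/(filt_le _ f1).
  + by exists (ch - one) => //; exact: filt_le f_ch1.
  + exists (- X1 R); first by rewrite commC [comm _ _ _]r23 alpha_mulN.
    by apply/filtN/(filt_le _ f1).
  + by exists (ch - one) => //; exact: filt_le f_ch1.
  + by exists sh => //; exact: filt_le f_sh.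
- by rewrite c1; do !apply: filtD; [exact: f2_le f1 f0|exact: f2_le f0 f1|
    exact: f2_le f_ch1 f2|exact: f2_le f_sh f3].
- by rewrite c2; do !apply: filtD; [exact: f2_le f2 f0|exact: f2_le f_ch f2|
    exact: f2_le f_sh f3].
- by rewrite c3; do !apply: filtD; [exact: f2_le f3 f0|exact: f2_le f_ch f3|
    exact: f2_le f_sh f2].
- by rewrite c4; do !apply: filtD; [exact: f2_le f4 f0|exact: f2_le f0 f4].
Qed.

Local Notation G' := (hgr G group_wt).

Lemma galilei_group_hgr : galilei_group G'.
Proof.
have hf := group_hfilt; have [hg _] := hf.
have bG' : bialgebra G' := bialgebra_hgr hf bG.
have [[c1 c2 c3 c4] [[r23 r12 r13] [r41 r42 r43]]] := relG.
have copE d x : filt w d x -> gr w d x = x -> cop G' x = gr w2 d (cop G x).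
  by move=> hx hgx; rewrite -cop_gr// hgx.
have commE d e x y : filt w d x -> filt w e y -> gr w d x = x -> gr w e y = y ->
    comm (prodc G') x y = gr w (d + e) (comm g x y).
  by move=> hx hy gx gy; rewrite -comm_gr// gx gy.
have tensE (d e f : int) (x y : series R mono) : d + e = f -> filt w d x -> filt w e y ->
    gr w2 f (tens x y) = tens (gr w d x) (gr w e y).
  by move=> <- hx hy; rewrite tens_gr.
have tens0 (d e f : int) (x y : series R mono) : d + e < f -> filt w d x -> filt w e y ->
    gr w2 f (tens x y) = 0.
  by move=> def hx hy; apply: gr_filt_lt def; exact: filt_tens.
(* The graded object is again a bialgebra with ordered monomials as basis, so its v^2 is a basis
   monomial. *)
have pow2 : pow (prodc G') (X4 R) 2 = monom R (0, 0, 0, 2)%N by exact: pow_X4.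
split; [split|split; [split|split]].
(* All four terms attain the weight -2; only the higher terms of cosh and sinh are lost. *)
- rewrite (copE _ _ f1 g1) c1 !grD (tensE (-2) 0)// (tensE 0 (-2))//.
  rewrite (tensE (-2) 0)// (tensE (-1) (-1))// g0 g1 g2 g3 gr_ch1 gr_sh.
  by rewrite tensZl pow2 -!addrA (addrC (tens (X4 R) _)).
- rewrite (copE _ _ f2 g2) c2 !grD (tensE 0 0)// (tensE 0 0)//.
  (* sinh chi (x) a1 has weight -2, below the weight 0 of a0. *)
  by rewrite (tens0 (-1) (-1))// g0 g2 gr_ch addr0.
- rewrite (copE _ _ f3 g3) c3 !grD (tensE (-1) 0)// (tensE 0 (-1))//.
  by rewrite (tensE (-1) 0)// g0 g2 g3 gr_ch gr_sh.
- by rewrite (copE _ _ f4 g4) c4 !grD (tensE (-1) 0)// (tensE 0 (-1))// g0 g4.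
- rewrite (commE _ _ _ _ f2 f3 g2 g3) r23 gr_alpha_mul.
  (* theta has weight -2, whereas weight 0 would be needed for alpha theta to survive. *)
  by rewrite (gr_filt_lt f1) ?alpha_mul0.
- by rewrite (commE _ _ _ _ f1 f2 g1 g2) r12 gr0.
- rewrite commC (commE _ _ _ _ f4 f2 g4 g2) r42 gr_alpha_mul.
  by rewrite (gr_filt_lt f_ch1) ?alpha_mul0 ?oppr0.
- rewrite (commE _ _ _ _ f1 f3 g1 g3) r13 gr_alpha_mul.
  by rewrite (_ : _ + 1 = -2 :> int)// g1.
- rewrite commC (commE _ _ _ _ f4 f1 g4 g1) r41 gr_alpha_mul.
  by rewrite (_ : _ + 1 = -2 :> int)// gr_ch1 alpha_mulZ pow2.
- rewrite commC (commE _ _ _ _ f4 f3 g4 g3) r43 gr_alpha_mul.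
  by rewrite (_ : _ + 1 = -1 :> int)// gr_sh.
Qed.

End Contracted_group.

(** * The contracted quantum algebra *)

Section Contracted_algebra.
Variables (R : realType) (U : hopf_data R).

Definition algebra_wt : int * int * int * int := (2, 0, 1, 1).

Local Notation g := (prodc U).
Local Notation w := (wt algebra_wt).
Local Notation w2 := (wprod w w).
Local Notation one := (monom R mono0).
Local Notation E := (fexp g (alpha_mul (X3 R))).
Local Notation E' := (fexp g (- alpha_mul (X3 R))).
Local Notation ch := (fcosh g (alpha_mul (X3 R))).
Local Notation U' := (hgr U algebra_wt).
Local Notation g' := (prodc U').

Hypotheses (relU : poincare_algebra U) (hf : hfilt U algebra_wt).

Let hg : sfilt w g := proj1 hf.
Let f0 : filt w 0 one. Proof. exact: filt_monom. Qed.
Let f1 : filt w 2 (X1 R). Proof. exact: filt_monom. Qed.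
Let f2 : filt w 0 (X2 R). Proof. exact: filt_monom. Qed.
Let f3 : filt w 1 (X3 R). Proof. exact: filt_monom. Qed.
Let f4 : filt w 1 (X4 R). Proof. exact: filt_monom. Qed.

Let g0 : gr w 0 one = one. Proof. exact: (gr_monom R w mono0). Qed.
Let g1 : gr w 2 (X1 R) = X1 R. Proof. exact: (gr_monom R w (1, 0, 0, 0)%N). Qed.
Let g2 : gr w 0 (X2 R) = X2 R. Proof. exact: (gr_monom R w (0, 1, 0, 0)%N). Qed.
Let g3 : gr w 1 (X3 R) = X3 R. Proof. exact: (gr_monom R w (0, 0, 1, 0)%N). Qed.
Let g4 : gr w 1 (X4 R) = X4 R. Proof. exact: (gr_monom R w (0, 0, 0, 1)%N). Qed.

(** alpha P1 is homogeneous of weight 0, which is why the exponentials persist unchanged in form. *)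
Let fa : filt w 0 (alpha_mul (X3 R)). Proof. exact: filt_alpha_mul. Qed.
Let ga : gr w 0 (alpha_mul (X3 R)) = alpha_mul (X3 R).
Proof. by rewrite gr_alpha_mul add0r g3. Qed.

Let fE : filt w 0 E. Proof. exact: filt_fexp. Qed.
Let fE' : filt w 0 E'. Proof. by apply: filt_fexp => //; exact: filtN. Qed.
Let gE : gr w 0 E = fexp g' (alpha_mul (X3 R)).
Proof. by rewrite -fexp_gr// ga. Qed.
Let gE' : gr w 0 E' = fexp g' (- alpha_mul (X3 R)).
Proof. by rewrite -fexp_gr// ?grN ?ga//; exact: filtN. Qed.

Lemma galilei_algebra_hgr : galilei_algebra U'.
Proof.
have [[c1 c2 c3 c4] [[r23 r12 r13] [r42 r43 r41]]] := relU.
have copE d x : filt w d x -> gr w d x = x -> cop U' x = gr w2 d (cop U x).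
  by move=> hx hgx; rewrite -cop_gr// hgx.
have commE d e x y : filt w d x -> filt w e y -> gr w d x = x -> gr w e y = y ->
    comm (prodc U') x y = gr w (d + e) (comm g x y).
  by move=> hx hy gx gy; rewrite -comm_gr// gx gy.
have tensE (d e f : int) (x y : series R mono) : d + e = f -> filt w d x -> filt w e y ->
    gr w2 f (tens x y) = tens (gr w d x) (gr w e y).
  by move=> <- hx hy; rewrite tens_gr.
(* P0 has weight 0, so M + P0 reduces to M. *)
have fMP : filt w 2 (X1 R + X2 R) by apply: filtD => //; exact: filt_le f2.
have gMP : gr w 2 (X1 R + X2 R) = X1 R.
  by rewrite grD g1 (gr_filt_lt f2) ?addr0.
split; [split|split; [split|split]].
- rewrite (copE _ _ f1 g1) c1 !grD (tensE 2 0)// (tensE 0 2)// g0 g1 gE'.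
  (* The term containing P0 has weight 0 and drops out of the part of weight 2. *)
  rewrite [X in _ + X](_ : _ = 0) ?addr0//.
  by apply: (@gr_filt_lt _ _ _ (0 + 0)) => //; apply: filt_tens => //; exact: filtB.
- by rewrite (copE _ _ f2 g2) c2 grD !(tensE 0 0)// g0 g2.
- by rewrite (copE _ _ f3 g3) c3 grD (tensE 1 0)// (tensE 0 1)// g0 g3.
- by rewrite (copE _ _ f4 g4) c4 grD (tensE 1 0)// (tensE 0 1)// g0 g4 gE.
- by rewrite (commE _ _ _ _ f2 f3 g2 g3) r23 gr0.
- by rewrite (commE _ _ _ _ f1 f2 g1 g2) r12 gr0.
- by rewrite (commE _ _ _ _ f1 f3 g1 g3) r13 gr0.
- rewrite (commE _ _ _ _ f4 f2 g4 g2) r42 gr_alpha_div.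
  by rewrite (_ : _ - 1 = 0 :> int)// grB gE g0.
- rewrite (commE _ _ _ _ f4 f3 g4 g3) r43.
  by rewrite (_ : 1 + 1 = 2 + 0 :> int)// -mul_gr// gMP gE.
- rewrite (commE _ _ _ _ f4 f1 g4 g1) r41 grN grD gr_alpha_div grZ gr_alpha_mul.
  rewrite (_ : 1 + 2 - 1 = 2 :> int)// (_ : 1 + 2 + 1 = 2 *+ 2 + 0 :> int)//.
  rewrite -mul_gr//; last exact: filt_pow.
  (* The cosh term disappears: cosh(alpha P1) - 1 has weight at most 0, and division by alpha would
     require weight 2. *)
  rewrite gE -pow_gr// gMP [X in alpha_div X](_ : _ = 0) ?alpha_div0 ?add0r//.
  apply: (@gr_filt_lt _ _ _ 0) => //; apply: filtB => //; apply: filtZ.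
  by apply: filtD.
Qed.

End Contracted_algebra.

(** * T-matrix and limits *)

Section T_matrix.
Variables (R : realType) (G U : hopf_data R).
Hypotheses (bG : bialgebra G) (bU : bialgebra U).

(** The sum of x^m (x) X^m / m! over the monomials m in [A]; the four exponentials and their partial
    products all have this shape. *)
Definition diag_series (A : pred mono) : series R (mono * mono)%type :=
  fun N p => if [&& N == 0%N, p.1 == p.2 & A p.1] then (mono_fact R p.1)^-1 else 0.

Lemma tens_exp_diag x X (f : nat -> mono) (n0 : mono -> nat) (A : pred mono) :
  (forall n, pow (prodc G) x n = monom R (f n)) ->
  (forall n, pow (prodc U) X n = monom R (f n)) ->
  (forall n, mono_fact R (f n) = n`!%:R) ->
  cancel f n0 -> (forall m, A m = (m == f (n0 m))) ->
  tens_exp (prodc G) (prodc U) x X = diag_series A.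
Proof.
move=> xf Xf ff fK Af; apply: seriesP => N [p q].
rewrite /tens_exp /fsum (fsbig_single (i0 := n0 p)) => [|n np].
  rewrite xf Xf tens_monom seriesZ /monom /diag_series /= xpair_eqE Af.
  case: (eqVneq N 0%N) => [_|_] /=; last by rewrite mulr0.
  case: (eqVneq p (f (n0 p))) => [pE|_] /=; last by rewrite andbF mulr0.
  rewrite andbT -pE eq_sym; case: eqP => [_|_]; last by rewrite mulr0.
  by rewrite mulr1 -ff -pE.
rewrite xf Xf tens_monom seriesZ /monom xpair_eqE.
case: (eqVneq p (f n)) np => [->|_ _]; last by rewrite andbF mulr0.
by rewrite fK eqxx.
Qed.

(** [q] and [r] recover the two factors of an ordered product, so exactly one pair can contribute to
    each coefficient. *)
Lemma mul_diag_series (A B C : pred mono) (f : mono -> mono -> mono) (q r : mono -> mono) :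
  (forall m n, A m -> B n ->
    [/\ prodc G m n = monom R (f m n), prodc U m n = monom R (f m n),
        q (f m n) = m, r (f m n) = n &
        mono_fact R (f m n) = mono_fact R m * mono_fact R n]) ->
  (forall l, C l = [&& A (q l), B (r l) & l == f (q l) (r l)]) ->
  mul (tens_structc (prodc G) (prodc U)) (diag_series A) (diag_series B) =
  diag_series C.
Proof.
move=> h hC; apply: seriesP => N [l l'].
rewrite (@mul_single _ _ 0%N 0%N ((q l, q l), (r l, r l)))//=.
  rewrite !subn0 tens_structcE /= /diag_series /= !eqxx /= hC.
  case: ifP => [Aq|_]; rewrite ?mul0r ?andbF//.
  case: ifP => [Br|_]; rewrite ?(mul0r, mulr0) ?andbF//.
  have [-> -> _ _ fE] := h _ _ Aq Br; rewrite tens_monom /monom xpair_eqE /=.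
  case: (eqVneq l (f _ _)) => [le|_] /=; last by rewrite !andbF mulr0.
  rewrite !andbT -le (eq_sym l'); case: ifP => _; rewrite ?mulr1 ?mulr0//.
  by rewrite -invfM -fE -le.
move=> i j [[m m'] [n n']] _ /=; apply: contraNeq.
rewrite !mulf_eq0 !negb_or /diag_series /= => /andP[/andP[]].
case: ifP => [/and3P[/eqP-> /eqP<- Am] _|_]; last by move=> /eqP[].
case: ifP => [/and3P[/eqP-> /eqP<- Bn] _|_]; last by move=> /eqP[].
have [mE nE qE rE _] := h _ _ Am Bn.
rewrite tens_structcE /= mE nE tens_monom /monom xpair_eqE !subn0.
case: (eqVneq l (f m n)) => [->|_]; last by rewrite andbF eqxx.
by rewrite qE rE !eqxx.
Qed.

Lemma T_matrixE : T_matrix G U = diag_series predT.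
Proof.
(* The digits in these names list the generators allowed to occur in the monomial. *)
pose pA1 : pred mono := fun m => [&& m.1.1.2 == 0, m.1.2 == 0 & m.2 == 0]%N.
pose pA2 : pred mono := fun m => [&& m.1.1.1 == 0, m.1.2 == 0 & m.2 == 0]%N.
pose pA3 : pred mono := fun m => [&& m.1.1.1 == 0, m.1.1.2 == 0 & m.2 == 0]%N.
pose pA4 : pred mono := fun m => [&& m.1.1.1 == 0, m.1.1.2 == 0 & m.1.2 == 0]%N.
pose pA12 : pred mono := fun m => [&& m.1.2 == 0 & m.2 == 0]%N.
pose pA123 : pred mono := fun m => (m.2 == 0)%N.
pose add (m n : mono) : mono :=
  (m.1.1.1 + n.1.1.1, m.1.1.2 + n.1.1.2, m.1.2 + n.1.2, m.2 + n.2)%N.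
have prodE (Q : hopf_data R) (bQ : bialgebra Q) m n o :
    mul (prodc Q) (monom R m) (monom R n) = monom R o -> prodc Q m n = monom R o.
  by rewrite mul_monomE.
rewrite /T_matrix.
rewrite (@tens_exp_diag _ _ (fun n => (n, 0, 0, 0)%N) (fun m => m.1.1.1) pA1)//;
  [|exact: pow_X1|exact: pow_X1|by move=> n; rewrite /mono_fact /= fact0 !muln1|
    by case=> [[[i j] k] l]; rewrite /pA1 /= !xpair_eqE eqxx /= andbA].
rewrite (@tens_exp_diag _ _ (fun n => (0, n, 0, 0)%N) (fun m => m.1.1.2) pA2)//;
  [|exact: pow_X2|exact: pow_X2|by move=> n; rewrite /mono_fact /= fact0 !muln1 mul1n|
    by case=> [[[i j] k] l]; rewrite /pA2 /= !xpair_eqE eqxx /= andbT andbA].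
rewrite (@tens_exp_diag _ _ (fun n => (0, 0, n, 0)%N) (fun m => m.1.2) pA3)//;
  [|exact: pow_X3|exact: pow_X3|by move=> n; rewrite /mono_fact /= fact0 !muln1 !mul1n|
    by case=> [[[i j] k] l]; rewrite /pA3 /= !xpair_eqE eqxx /= andbT andbA].
rewrite (@tens_exp_diag _ _ (fun n => (0, 0, 0, n)%N) (fun m => m.2) pA4)//;
  [|exact: pow_X4|exact: pow_X4|by move=> n; rewrite /mono_fact /= fact0 !mul1n|
    by case=> [[[i j] k] l]; rewrite /pA4 /= !xpair_eqE eqxx /= andbT andbA].
rewrite (@mul_diag_series pA1 pA2 pA12 add
  (fun m => (m.1.1.1, 0, 0, 0)%N) (fun m => (0, m.1.1.2, 0, 0)%N)); first last.
- by case=> [[[i j] k] l]; rewrite /pA1 /pA2 /add !xpair_eqE /= addn0 !eqxx.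
- move=> [[[i j] k] l] [[[i' j'] k'] l'].
  move=> /and3P[/= /eqP-> /eqP-> /eqP->] /and3P[/= /eqP-> /eqP-> /eqP->].
  rewrite /add /= !addn0 add0n; split=> //; try by apply: prodE; rewrite // mul_X12.
  by rewrite /mono_fact /= fact0 !muln1 mul1n natrM.
rewrite (@mul_diag_series pA12 pA3 pA123 add
  (fun m => (m.1.1.1, m.1.1.2, 0, 0)%N) (fun m => (0, 0, m.1.2, 0)%N)); first last.
- by case=> [[[i j] k] l]; rewrite /pA12 /pA3 /pA123 /add !xpair_eqE /= !addn0 !eqxx.
- move=> [[[i j] k] l] [[[i' j'] k'] l'].
  move=> /andP[/= /eqP-> /eqP->] /and3P[/= /eqP-> /eqP-> /eqP->].
  rewrite /add /= !addn0 add0n; split=> //; try by apply: prodE; rewrite // mul_X123.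
  by rewrite /mono_fact /= fact0 !muln1 !mul1n natrM.
rewrite (@mul_diag_series pA123 pA4 predT add
  (fun m => (m.1.1.1, m.1.1.2, m.1.2, 0)%N) (fun m => (0, 0, 0, m.2)%N))//.
- move=> [[[i j] k] l] [[[i' j'] k'] l'].
  move=> /= /eqP/= -> /and3P[/= /eqP-> /eqP-> /eqP->].
  rewrite /add /= !addn0 add0n; split=> //; try by apply: prodE; rewrite // mul_X1234.
  by rewrite /mono_fact /= fact0 !muln1 !mul1n natrM.
- by case=> [[[i j] k] l]; rewrite /pA123 /pA4 /add !xpair_eqE /= !addn0 !eqxx.
Qed.

End T_matrix.

(** * Limits of the rescaled structure maps *)

Section Limits.
Variable R : realType.

Lemma cvg_exprz_lt0 (e : int) : e < 0 -> (c : R) ^ e @[c --> +oo] --> (0 : R).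
Proof.
case: e => // n _.
have V0 : (c : R)^-1 @[c --> +oo] --> (0 : R).
  by apply/gtr0_cvgV0; [exact: nbhs_pinfty_gt|exact: cvg_id].
rewrite (_ : (fun c : R => c ^ Negz n) = (fun c => c^-1 ^+ n.+1)); last first.
  by apply/funext => c; rewrite exprVn.
elim: n => [|n IHn]; first by under eq_cvg do rewrite expr1.
under eq_cvg do rewrite exprS.
by have := cvgM V0 IHn; rewrite mulr0; exact.
Qed.

(** The laws for integer powers of [c] are applied for nonzero [c] only, which holds eventually at
    infinity. *)
Lemma cvg_at_pinfty_eq (f h : R -> R) (l : R) : (forall c, c != 0 -> f c = h c) ->
  h c @[c --> +oo] --> l -> f c @[c --> +oo] --> l.
Proof.
move=> fh; apply: cvg_trans; apply: near_eq_cvg; near=> c.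
rewrite fh// gt_eqF//; near: c; exact: nbhs_pinfty_gt.
Unshelve. all: by end_near. Qed.

(** The common form of [phi] and [varphi]: the exponent is minus the weight of alpha^N X^m. *)
Definition resc (I : Type) (c : R) (w : I -> int) (x : series R I) : series R I :=
  fun N m => c ^ (N%:Z - w m) * x N m.

Section Product.
Variables (I : choiceType) (w : I -> int) (g : structc R I).

(** After conjugation each term carries c^e, with e the weight of the output minus those of the
    inputs. The filtration gives e <= 0, so the terms with e = 0 remain and the others tend to 0. *)
Lemma cvg_mul_resc x y N l : sfilt w g ->
  (forall i j K, finite_set [set p : I * I | x i p.1 * y j p.2 * g p.1 p.2 K l != 0]) ->
  c ^ (w l - N%:Z) * mul g (resc c w x) (resc c w y) N l @[c --> +oo] -->
  (mul (sgr w g) x y N l : R).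
Proof.
move=> hg fin; pose e i j (p : I * I) : int :=
  w l - (N - i - j)%N%:Z - (w p.1 + w p.2).
apply: (@cvg_at_pinfty_eq _ (fun c => \sum_(i < N.+1) \sum_(j < (N - i).+1)
    \sum_(p \in [set: I * I])
      (x i p.1 * y j p.2 * g p.1 p.2 (N - i - j)%N l * c ^ e i j p))).
  move=> c c0; rewrite /mul mulr_sumr; apply: eq_bigr => i _.
  rewrite mulr_sumr; apply: eq_bigr => j _; rewrite mulr_fsumr.
  apply: eq_fsbigr => p _; rewrite /resc.
  have -> : e i j p = (w l - N%:Z) + (i%:Z - w p.1) + (j%:Z - w p.2).
    by rewrite /e; have := ltn_ord i; have := ltn_ord j; lia.
  by rewrite !expfzDr//; set a := c ^ _; set b := c ^ _; set d := c ^ _; ring.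
apply: cvg_big => [|i _]; first exact: add_continuous.
apply: cvg_big => [|j _]; first exact: add_continuous.
apply: (cvg_fsbig (fin i j (N - i - j)%N)) => [c p ->|p]; first by rewrite mul0r.
have [g0|gN0] := eqVneq (g p.1 p.2 (N - i - j)%N l) 0.
  rewrite /sgr /gr g0 if_same !mulr0; under eq_cvg do rewrite mul0r.
  exact: cvg_cst.
have le_e : e i j p <= 0 by have := hg _ _ _ _ gN0; rewrite /e; lia.
have -> : sgr w g p.1 p.2 (N - i - j)%N l =
    g p.1 p.2 (N - i - j)%N l * (if e i j p == 0 then 1 else 0).
  rewrite /sgr /gr (_ : (w l == _) = (e i j p == 0)); last first.
    by apply/eqP/eqP; rewrite /e; lia.
  by case: ifP; rewrite ?mulr1 ?mulr0.
rewrite mulrA; apply: cvgMr => //; case: eqP => [->|e0].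
  by under eq_cvg do rewrite expr0z; exact: cvg_cst.
by apply: cvg_exprz_lt0; lia.
Qed.

End Product.

Lemma cvg_cop_resc (Q : hopf_data R) s x N p : hfilt Q s ->
  (forall i K, finite_set [set m | x i m * copc Q m K p != 0]) ->
  c ^ (wprod (wt s) (wt s) p - N%:Z) * cop Q (resc c (wt s) x) N p @[c --> +oo] -->
  (cop (hgr Q s) x N p : R).
Proof.
move=> [_ hc] fin; pose e i m : int :=
  wprod (wt s) (wt s) p - (N - i)%N%:Z - wt s m.
apply: (@cvg_at_pinfty_eq _ (fun c => \sum_(i < N.+1)
    \sum_(m \in [set: mono]) (x i m * copc Q m (N - i)%N p * c ^ e i m))).
  move=> c c0; rewrite /cop mulr_sumr; apply: eq_bigr => i _.
  rewrite mulr_fsumr; apply: eq_fsbigr => m _; rewrite /resc.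
  have -> : e i m = (wprod (wt s) (wt s) p - N%:Z) + (i%:Z - wt s m).
    by rewrite /e; have := ltn_ord i; lia.
  by rewrite !expfzDr//; set a := c ^ _; set b := c ^ _; ring.
apply: cvg_big => [|i _]; first exact: add_continuous.
apply: (cvg_fsbig (fin i (N - i)%N)) => [c m ->|m]; first by rewrite mul0r.
have [g0|gN0] := eqVneq (copc Q m (N - i)%N p) 0.
  rewrite /= /gr g0 if_same !mulr0; under eq_cvg do rewrite mul0r.
  exact: cvg_cst.
have le_e : e i m <= 0 by have := hc _ _ _ gN0; rewrite /e; lia.
have -> : copc (hgr Q s) m (N - i)%N p =
    copc Q m (N - i)%N p * (if e i m == 0 then 1 else 0).
  rewrite /= /gr (_ : (wprod _ _ p == _) = (e i m == 0)); last first.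
    by apply/eqP/eqP; rewrite /e; lia.
  by case: ifP; rewrite ?mulr1 ?mulr0.
rewrite mulrA; apply: cvgMr => //; case: eqP => [->|e0].
  by under eq_cvg do rewrite expr0z; exact: cvg_cst.
by apply: cvg_exprz_lt0; lia.
Qed.

Lemma wt_algebraE m : wt algebra_wt m = (2 * m.1.1.1 + m.1.2 + m.2)%N%:Z.
Proof. by rewrite /wt /= mul0rn addr0; lia. Qed.

Lemma wt_groupE m : wt group_wt m = - wt algebra_wt m.
Proof. by rewrite /wt /= !mul0rn !addr0 !mulNrn !opprD. Qed.

Lemma mono_eval_up (c : R) m : mono_eval (scale_up c) m = c ^ wt algebra_wt m.
Proof. by rewrite wt_algebraE -exprnP exprD exprD exprM /mono_eval /= expr1n mulr1. Qed.

Lemma mono_eval_down (c : R) m : mono_eval (scale_down c) m = c ^ (- wt algebra_wt m).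
Proof.
rewrite wt_algebraE -exprnN exprD exprD exprM /mono_eval /= expr1n mulr1.
by rewrite !exprVn -!invfM.
Qed.

Lemma phiE (c : R) x : c != 0 -> phi c x = resc c (wt algebra_wt) x.
Proof.
move=> c0; apply: seriesP => N m; rewrite /phi /rescale /resc mono_eval_down.
by rewrite expfzDr// -exprnP.
Qed.

Lemma phi_invE (c : R) x N m : c != 0 ->
  phi_inv c x N m = c ^ (wt algebra_wt m - N%:Z) * x N m.
Proof.
move=> c0; rewrite /phi_inv /rescale mono_eval_up [in RHS]expfzDr// -exprnN exprVn.
by rewrite (mulrC (c ^ _)).
Qed.

Lemma phi_inv2E (c : R) x N p : c != 0 -> phi_inv2 c x N p =
  c ^ (wprod (wt algebra_wt) (wt algebra_wt) p - N%:Z) * x N p.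
Proof.
move=> c0; rewrite /phi_inv2 /rescale2 !mono_eval_up /wprod.
rewrite [in RHS]expfzDr// -exprnN exprVn [in RHS]expfzDr//.
by congr (_ * _); rewrite -mulrA mulrC.
Qed.

Lemma varphiE (c : R) x : c != 0 -> varphi c x = resc c (wt group_wt) x.
Proof.
move=> c0; apply: seriesP => N m; rewrite /varphi /rescale /resc mono_eval_up.
by rewrite wt_groupE opprK [in RHS]expfzDr// -exprnP.
Qed.

Lemma varphi_invE (c : R) x N m : c != 0 ->
  varphi_inv c x N m = c ^ (wt group_wt m - N%:Z) * x N m.
Proof.
move=> c0; rewrite /varphi_inv /rescale mono_eval_down wt_groupE [in RHS]expfzDr//.
by rewrite -(exprnN c N) exprVn (mulrC (c ^ _)).
Qed.

Lemma varphi_inv2E (c : R) x N p : c != 0 -> varphi_inv2 c x N p =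
  c ^ (wprod (wt group_wt) (wt group_wt) p - N%:Z) * x N p.
Proof.
move=> c0; rewrite /varphi_inv2 /rescale2 !mono_eval_down /wprod !wt_groupE.
rewrite [in RHS]expfzDr// -(exprnN c N) exprVn [in RHS]expfzDr//.
by congr (_ * _); rewrite -mulrA mulrC.
Qed.

(** Opposite powers of [c] on the two tensor factors cancel on the diagonal. *)
Lemma varphi_phi_diag_series (c : R) A : c != 0 ->
  varphi_phi c (diag_series R A) = diag_series R A.
Proof.
move=> c0; apply: seriesP => N p; rewrite /varphi_phi /rescale2 /diag_series.
case: ifP => [/and3P[/eqP-> /eqP-> _]|_]; last by rewrite mulr0.
by rewrite mono_eval_up mono_eval_down expr0 mul1r -expfzDr// subrr expr0z mul1r.
Qed.

Lemma algebra_contraction_hgr (U : hopf_data R) :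
  hfilt U algebra_wt -> algebra_contraction U (hgr U algebra_wt).
Proof.
move=> hf; split=> [X Y pX pY N l|X pX N p].
  (* Here the sums are finite because the arguments are polynomial at each order in alpha; for the
     group the finiteness comes from the structure constants. *)
  have finXY (Z W : series R mono) : poly_series Z -> poly_series W ->
      forall i j K, finite_set
        [set p : mono * mono | Z i p.1 * W j p.2 * prodc U p.1 p.2 K l != 0].
    move=> pZ pW i j K; apply: sub_finite_set (finite_setX (pZ i) (pW j)).
    by move=> p /=; rewrite !mulf_eq0 !negb_or => /andP[/andP[]].
  rewrite [comm (prodc (hgr _ _)) _ _]/comm seriesB.
  apply: (cvg_at_pinfty_eq _ (cvgB (cvg_mul_resc hf.1 (finXY _ _ pX pY))
    (cvg_mul_resc hf.1 (finXY _ _ pY pX)))) => c c0.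
  by rewrite phi_invE// !phiE// /comm seriesB mulrBr.
apply: (cvg_at_pinfty_eq _ (cvg_cop_resc hf _)) => [c c0|i K].
  by rewrite phi_inv2E// phiE.
apply: sub_finite_set (pX i) => m /=.
by rewrite mulf_eq0 negb_or => /andP[].
Qed.

Lemma group_contraction_hgr (G : hopf_data R) :
  grp_finite G -> hfilt G group_wt ->
  group_contraction G (hgr G group_wt).
Proof.
move=> [finG finc] hf; split=> [x y N l|x N p].
  have fin (z t : series R mono) i j K : finite_set
      [set p : mono * mono | z i p.1 * t j p.2 * prodc G p.1 p.2 K l != 0].
    by apply: sub_finite_set (finG K l) => p /=; rewrite mulf_eq0 negb_or => /andP[].
  rewrite [comm (prodc (hgr _ _)) _ _]/comm seriesB.
  apply: (cvg_at_pinfty_eq _ (cvgB (cvg_mul_resc hf.1 (fin x y))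
    (cvg_mul_resc hf.1 (fin y x)))) => c c0.
  by rewrite varphi_invE// !varphiE// /comm seriesB mulrBr.
apply: (cvg_at_pinfty_eq _ (cvg_cop_resc hf _)) => [c c0|i K].
  by rewrite varphi_inv2E// varphiE.
apply: sub_finite_set (finc K p) => m /=.
by rewrite mulf_eq0 negb_or => /andP[].
Qed.

End Limits.

Theorem mainTheorem7 (R : realType) (U G : hopf_data R)
  (hU : quantum_algebra U) (relU : poincare_algebra U)
  (hG : quantum_group G) (relG : poincare_group G)
  (dualGU : dual_pair G U) :
  exists U' G' : hopf_data R,
    [/\ [/\ quantum_algebra U', galilei_algebra U' & algebra_contraction U U'],
        [/\ quantum_group G', galilei_group G' & group_contraction G G'] &
        dual_pair G' U' /\
        termwise_lim (fun c => varphi_phi c (T_matrix G U)) (T_matrix G' U')].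
Proof.
have [[fU bU] [fG bG]] := (hU, hG).
have hfG := group_hfilt hG relG.
(* The algebra is not commutative modulo alpha, so its filtration is obtained from the group by
   duality. *)
have hfU : hfilt U algebra_wt := dual_hfilt wt_groupE dualGU hfG.
have bU' := bialgebra_hgr hfU bU; have bG' := bialgebra_hgr hfG bG.
exists (hgr U algebra_wt), (hgr G group_wt); split; [split|split|split].
- by split=> //; exact: alg_finite_hgr.
- exact: galilei_algebra_hgr.
- exact: algebra_contraction_hgr.
- by split=> //; exact: grp_finite_hgr.
- exact: galilei_group_hgr.
- exact: group_contraction_hgr.
- exact: dual_hgr wt_groupE dualGU.
- move=> N p; rewrite !T_matrixE//.
  apply: (@cvg_at_pinfty_eq _ _ (fun=> diag_series R predT N p)) => [c c0|].
    by rewrite varphi_phi_diag_series.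
  exact: cvg_cst.
Qed.
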